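(* Let $(G,X)$ be a Polish topological dynamical system, where $G$ is locally compact. Suppose that there exists a $G$-invariant Borel probability measure $\mu$ on $X$. Let $\mathcal{E}$ be the non-empty set of ergodic Borel probability measures on $X$, and supply $\mathcal{E}$ with the weak$^*$-topology induced by $\mathrm{C_b}(X)$. Let $\beta:X\to\mathcal{E}$ be a decomposition map, and let $\nu$ be the push-forward measure of $\mu$ via $\beta$, so that $\nu$ is a Borel probability measure on $\mathcal{E}$ that is independent of the choice of $\beta$. Let $1\le p<\infty$. (1) Let $V$ be the vector space (vector lattice) of simple functions on $X$ and, for $\lambda\in\mathcal{E}$, let $\|f\|_\lambda:=\|f\|_{\mathcal{L}^p(X,\lambda)}$ $(f\in V)$. Then $\{\|\cdot\|_\lambda\}_{\lambda\in\mathcal{E}}$ is a measurable family of semi-norms on $V$. The resulting family of completions of the spaces $(V/\ker(\|\cdot\|_\lambda),\|\cdot\|_\lambda)$ is the family $\{\mathrm{L}^p(X,\lambda)\}_{\lambda\in\mathcal{E}}$, which is a measurable family of Banach lattices over $(\mathcal{E},\nu,V)$. Therefore, the $\mathrm{L}^p$-direct integral $\left(\int_{\mathcal{E}}^{\oplus}\mathrm{L}^p(X,\lambda)\,\mathrm{d}\nu(\lambda)\right)_{\mathrm{L}^p}$ of this family with respect to $\nu$ can be defined, and this space is a Banach lattice. (2) For $f\in\mathcal{L}^p(X,\mu)$, let $s_f$ be the section of $\{\mathrm{L}^p(X,\lambda)\}_{\lambda\in\mathcal{E}}$ given by $s_f(\lambda):=[f]_\lambda$ if $f\in\mathcal{L}^p(X,\lambda)$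 and $s_f(\lambda):=[0]_\lambda$ otherwise. Define $S:\mathrm{L}^p(X,\mu)\to\left(\int_{\mathcal{E}}^{\oplus}\mathrm{L}^p(X,\lambda)\,\mathrm{d}\nu(\lambda)\right)_{\mathrm{L}^p}$ by $S([f]_\mu):=[s_f]_\nu$ $(f\in\mathcal{L}^p(X,\mu))$. Then $S$ is a (well-defined) isometric lattice isomorphism between the Banach lattices $\mathrm{L}^p(X,\mu)$ and $\left(\int_{\mathcal{E}}^{\oplus}\mathrm{L}^p(X,\lambda)\,\mathrm{d}\nu(\lambda)\right)_{\mathrm{L}^p}$. (3) $S$ is an intertwining operator between the canonical representation $\rho_\mu$ of $G$ as isometric lattice automorphisms of $\mathrm{L}^p(X,\mu)$ and the representation $\left(\int_{\mathcal{E}}^{\oplus}\rho_\lambda\,\mathrm{d}\nu(\lambda)\right)_{\mathrm{L}^p}$ on $\left(\int_{\mathcal{E}}^{\oplus}\mathrm{L}^p(X,\lambda)\,\mathrm{d}\nu(\lambda)\right)_{\mathrm{L}^p}$, which is the $\mathrm{L}^p$-direct integral of the family $\{\rho_\lambda\}_{\lambda\in\mathcal{E}}$ of canonical representations of $G$ as isometric lattice automorphisms on the Banach lattices $\mathrm{L}^p(X,\lambda)$ $(\lambda\in\mathcal{E})$. That is, for each $g\in G$, $$S\circ\rho_\mu(g)=\left(\int_{\mathcal{E}}^{\oplus}\rho_\lambda(g)\,\mathrm{d}\nu(\lambda)\right)_{\mathrm{L}^p}\circ S.$$ (4) For all $\lambda\in\mathcal{E}$, the representation $\rho_\lambda$ of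 $G$ on the fiber $\mathrm{L}^p(X,\lambda)$ is order indecomposable.
   Context: All vector spaces are real. Dynamical systems and ergodic measures. A Polish topological dynamical system is a pair $(G,X)$ where the Polish topological group $G$ acts as homeomorphisms on the Polish space $X$ such that $(g,x)\mapsto gx$ is continuous from $G\times X$ to $X$. A Borel measure $\lambda$ on $X$ is $G$-invariant if $\lambda(gY)=\lambda(Y)$ for all $g\in G$ and Borel $Y\subseteq X$. A Borel set $Y$ is $\lambda$-essentially $G$-invariant if $\lambda(gY\mathbin{\Delta}Y)=0$ for all $g\in G$. An ergodic Borel probability measure is a $G$-invariant Borel probability measure $\lambda$ such that $\lambda(Y)\in\{0,1\}$ for each $\lambda$-essentially $G$-invariant Borel set $Y$. The set $\mathcal{E}$ of these carries the coarsest topology making $\lambda\mapsto\int_X h\,\mathrm{d}\lambda$ continuous for all bounded continuous $h\in\mathrm{C_b}(X)$, and the ensuing Borel $\sigma$-algebra. A decomposition map is a Borel measurable map $\beta:X\to\mathcal{E}$, $x\mapsto\beta_x$, such that (i) $\beta_{gx}=\beta_x$ for all $x\in X$, $g\in G$; (ii) $\lambda(\beta^{-1}(\{\lambda\}))=1$ for all $\lambda\in\mathcal{E}$; (iii) $\mu'(Y)=\int_X\beta_x(Y)\,\mathrm{d}\mu'(x)$ for all $G$-invariant Borel probability measures $\mu'$ on $X$ and all Borel $Y\subseteq X$. (Under the stated hypotheses $\mathcal{E}\ne\emptyset$ and a decomposition map exists, by work of Farrell and Varadarajan.) The push-forward is $\nu(A)=\mu(\beta^{-1}(A))$ for Borel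 $A\subseteq\mathcal{E}$. $\mathrm{L}^p$-spaces and canonical representations. $\mathcal{L}^p(X,\lambda)$ is the semi-normed space of Borel measurable $p$-integrable extended functions $f:X\to\mathbb{R}\cup\{-\infty,\infty\}$ (not identified almost everywhere); $\mathrm{L}^p(X,\lambda)$ is the Banach lattice of classes $[f]_\lambda$ under $\lambda$-a.e. equality. For $G$-invariant $\lambda$, the canonical representation is $\rho_\lambda(g)[f]_\lambda:=[x\mapsto f(g^{-1}x)]_\lambda$. A representation of $G$ as lattice automorphisms of a vector lattice $E$ is order indecomposable if $\{0\}$ and $E$ are the only $G$-invariant projection bands in $E$. Direct integrals. Let $(\Omega,\nu)$ be a measure space and $V$ a vector space. A measurable family of semi-norms on $V$ is a family $\{\|\cdot\|_\omega\}_{\omega\in\Omega}$ of semi-norms on $V$ such that $\omega\mapsto\|x\|_\omega$ is measurable for each $x\in V$. A family $\{B_\omega\}_{\omega\in\Omega}$ of Banach spaces is a measurable family of Banach spaces over $(\Omega,\nu,V)$ if, for such a family of semi-norms, each $B_\omega$ is the completion of $V/\ker(\|\cdot\|_\omega)$ in the induced norm; $[x]_\omega$ is the class of $x$. It is a measurable family of Banach lattices if moreover $V$ is a vector lattice, the $\|\cdot\|_\omega$ are lattice semi-norms, and $B_\omega$ is the Banach lattice completion of $V/\ker(\|\cdot\|_\omega)$ with the induced lattice norm and ordering. A section is a map $s:\Omega\to\bigsqcup_\omega B_\omega$ with $s(\omega)\in B_\omega$. A simple section is one of the form $s(\omega)=\left[\sum_{k=1}^n\mathbf{1}_{A_k}(\omega)x_k\right]_\omega$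 with $n\in\mathbb{N}$, $x_k\in V$, $A_k\subseteq\Omega$ measurable. A section $s$ is measurable if there are simple sections $s_k$ with $s_k(\omega)\to s(\omega)$ in $B_\omega$ for all $\omega\in\Omega$ (then $\omega\mapsto\|s(\omega)\|_\omega$ is measurable). For $1\le p<\infty$, $\left(\int_\Omega^{\oplus}B_\omega\,\mathrm{d}\nu(\omega)\right)_{\mathrm{L}^p}$ is the space of classes $[s]_\nu$ (under $\nu$-a.e. equality) of measurable sections $s$ such that $\int_\Omega\|s(\omega)\|_\omega^p\,\mathrm{d}\nu(\omega)<\infty$, with norm $\|[s]_\nu\|_p=\left(\int_\Omega\|s(\omega)\|_\omega^p\,\mathrm{d}\nu(\omega)\right)^{1/p}$ and, in the lattice case, the ordering $[s]_\nu\ge[t]_\nu$ iff $s(\omega)\ge t(\omega)$ for $\nu$-almost all $\omega$. Decomposable operators and representations. A decomposable operator on $\{B_\omega\}_{\omega\in\Omega}$ is a family $\{T_\omega\}_{\omega\in\Omega}$ of bounded operators $T_\omega$ on $B_\omega$ such that $\omega\mapsto T_\omega(s(\omega))$ is a measurable section for each measurable section $s$ and $\omega\mapsto\|T_\omega\|$ is $\nu$-essentially bounded; it induces the bounded operator $\left(\int_\Omega^{\oplus}T_\omega\,\mathrm{d}\nu(\omega)\right)_{\mathrm{L}^p}:[s]_\nu\mapsto[\omega\mapsto T_\omega s(\omega)]_\nu$. A decomposable representation of $G$ is a family $\{\rho_\omega\}_{\omega\in\Omega}$ of representations of $G$ on the $B_\omega$ such that $\{\rho_\omega(g)\}_{\omega\in\Omega}$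 is a decomposable operator for each $g\in G$; its $\mathrm{L}^p$-direct integral is the representation $g\mapsto\left(\int_\Omega^{\oplus}\rho_\omega(g)\,\mathrm{d}\nu(\omega)\right)_{\mathrm{L}^p}$. *)

(* Defs.v *)
From HB Require Import structures.
From mathcomp Require Import all_boot all_order all_algebra.
From mathcomp Require Import all_classical all_reals all_analysis.
From mathcomp Require Import measurable_realfun.

Set Implicit Arguments.
Unset Strict Implicit.
Unset Printing Implicit Defensive.

Import Order.TTheory GRing.Theory Num.Theory.
Import numFieldNormedType.Exports HBSimple.

Local Open Scope classical_set_scope.
Local Open Scope ring_scope.

(* Vector space structure on a quotient [Q] of a vector space [W] by a
   compatible equivalence relation. *)
HB.factory Record isLmodQuotient (R : nzRingType) (W : lmodType R) Q
    & Choice Q := {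
  quo_class : W -> Q;
  quo_repr : Q -> W;
  quo_reprK : cancel quo_repr quo_class;
  quo_classD : forall f f' g g', quo_class f = quo_class f' ->
    quo_class g = quo_class g' -> quo_class (f + g) = quo_class (f' + g');
  quo_classZ : forall a f f', quo_class f = quo_class f' ->
    quo_class (a *: f) = quo_class (a *: f')
}.

HB.builders Context R W Q & isLmodQuotient R W Q.

Let add (x y : Q) := quo_class (quo_repr x + quo_repr y).
Let scale a (x : Q) := quo_class (a *: quo_repr x).
Let opp (x : Q) := quo_class (- quo_repr x).

Let classD f g : quo_class (f + g) = add (quo_class f) (quo_class g).
Proof. by apply: quo_classD; rewrite quo_reprK. Qed.

Let classZ a f : quo_class (a *: f) = scale a (quo_class f).
Proof. by apply: quo_classZ; rewrite quo_reprK. Qed.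

Let addA : associative add.
Proof.
move=> x y z; rewrite -[x]quo_reprK -[y]quo_reprK -[z]quo_reprK.
by rewrite -!classD addrA.
Qed.

Let addC : commutative add.
Proof. by move=> x y; rewrite /add addrC. Qed.

Let add0 : left_id (quo_class 0) add.
Proof. by move=> x; rewrite -[x]quo_reprK -classD add0r. Qed.

Let addN : left_inverse (quo_class 0) opp add.
Proof. by move=> x; rewrite -{2}[x]quo_reprK -classD addNr. Qed.

HB.instance Definition _ := GRing.isZmodule.Build Q addA addC add0 addN.

Let scaleA a b x : scale a (scale b x) = scale (a * b) x.
Proof. by rewrite -[x]quo_reprK -!classZ scalerA. Qed.

Let scale1 : left_id 1 scale.
Proof. by move=> x; rewrite -[x]quo_reprK -classZ scale1r. Qed.

Let scaleDr : right_distributive scale +%R.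
Proof.
move=> a x y; rewrite -[x]quo_reprK -[y]quo_reprK.
rewrite -[_ + _]classD -classZ scalerDr.
by rewrite -[RHS]/(add _ _) -!classZ -classD.
Qed.

Let scaleDl x : {morph scale^~ x : a b / a + b}.
Proof.
move=> a b; rewrite -[x]quo_reprK -classZ scalerDl.
by rewrite -[RHS]/(add _ _) -!classZ -classD.
Qed.

HB.instance Definition _ :=
  GRing.Zmodule_isLmodule.Build R Q scaleA scale1 scaleDr scaleDl.

HB.end.


(* A separate order relation: in the MathComp hierarchy, [<=%R] together with a
   norm forces a numeric ring structure. *)
HB.mixin Record isOrderedVectorSpace (R : numDomainType) V
    & GRing.Lmodule R V := {
  vle : V -> V -> Prop;
  vle_refl : forall x, vle x x;
  vle_anti : forall x y, vle x y -> vle y x -> x = y;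
  vle_trans : forall y x z, vle x y -> vle y z -> vle x z;
  vleD2r : forall z x y, vle x y -> vle (x + z) (y + z);
  vleZ : forall (a : R) x y, 0 <= a -> vle x y -> vle (a *: x) (a *: y)
}.

#[short(type="orderedVectorType")]
HB.structure Definition OrderedVectorSpace (R : numDomainType) :=
  {V of GRing.Lmodule R V & isOrderedVectorSpace R V}.

#[short(type="orderedNormedType")]
HB.structure Definition OrderedNormedSpace (R : numDomainType) :=
  {V of NormedModule R V & isOrderedVectorSpace R V}.

Notation "x ≼ y" := (vle x y) (at level 70, no associativity).

Section Lp.
Context d (T : measurableType d) (R : realType).
Variables (mu : {measure set T -> \bar R}) (p : R).
Implicit Types f g : T -> \bar R.

(* Extended real valued functions, not identified almost everywhere. *)
Definition Lp_integrable : {pred T -> \bar R} :=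
  mem [set f : T -> \bar R |
       measurable_fun setT f /\ ('N[mu]_(p%:E)[f] < +oo)%E].

Record Lp_fun := LpFun { Lp_val :> T -> \bar R; _ : Lp_val \in Lp_integrable }.

HB.instance Definition _ := [isSub for Lp_val].
HB.instance Definition _ := gen_eqMixin Lp_fun.
HB.instance Definition _ := gen_choiceMixin Lp_fun.

Definition Lp_eq (f g : Lp_fun) := `[< f = g %[ae mu] >].

Let Lp_eq_refl : reflexive Lp_eq.
Proof. by move=> f; exact/asboolP/ae_eq_refl. Qed.

Let Lp_eq_sym : symmetric Lp_eq.
Proof. by move=> f g; apply/idP/idP => /asboolP h; apply/asboolP/ae_eq_sym. Qed.

Let Lp_eq_trans : transitive Lp_eq.
Proof.
by move=> f g h /asboolP gf /asboolP fh; apply/asboolP/(ae_eq_trans gf fh).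
Qed.

Canonical Lp_equiv := EquivRel Lp_eq Lp_eq_refl Lp_eq_sym Lp_eq_trans.

Local Open Scope quotient_scope.

Definition Lp (_ : 1 <= p) : Type := {eq_quot Lp_eq}.

Lemma Lnorm_ae_eq f g : measurable_fun setT f -> measurable_fun setT g ->
  f = g %[ae mu] -> ('N[mu]_(p%:E)[f] = 'N[mu]_(p%:E)[g])%E.
Proof.
move=> mf mg fg; rewrite unlock /Lnorm; congr (_ `^ _)%E.
apply: ae_eq_integral => //.
- exact/(measurableT_comp (measurable_poweR p))/measurableT_comp.
- exact/(measurableT_comp (measurable_poweR p))/measurableT_comp.
- by apply: filterS fg => x /(_ Logic.I) -> _.
Qed.

Section Lp_ge1.
Hypothesis p1 : 1 <= p.

Let p0 : 0 < p. Proof. exact: lt_le_trans p1. Qed.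

Lemma Lp_integrable_fin f : f \in Lp_integrable ->
  {ae mu, forall x, f x \is a fin_num}.
Proof.
rewrite inE => -[mf fy].
have : mu.-integrable setT (fun x => `|f x| `^ p)%E.
  apply/integrableP; split.
    exact/(measurableT_comp (measurable_poweR p))/measurableT_comp.
  under eq_integral do rewrite gee0_abs ?poweR_ge0//.
  by rewrite -powR_Lnorm ?gt_eqF//; exact: poweR_lty.
move=> /(integrable_ae measurableT); apply: filterS => x /(_ Logic.I).
by case: (f x) => [r _|/=|/=]; rewrite ?(gt_eqF p0).
Qed.

Lemma Lp_integrable_fine f : f \in Lp_integrable ->
  (fine \o f) \in Lfun mu p%:E.
Proof.
move=> fP; have := Lp_integrable_fin fP.
move: fP; rewrite inE => -[mf fy] ffin.
have mff : measurable_fun setT (fine \o f).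
  exact/measurableT_comp/mf/fine_measurable.
rewrite inE; apply/andP; split; rewrite inE//= /finite_norm.
rewrite (@Lnorm_ae_eq _ f)//; first exact/measurable_EFinP.
by apply: filterS ffin => x fx _ /=; rewrite fineK.
Qed.

Lemma Lp_integrable_EFin (f : T -> R) : f \in Lfun mu p%:E ->
  (EFin \o f) \in Lp_integrable.
Proof.
rewrite inE => /andP[]; rewrite !inE => mf fy.
by split=> //; exact/measurable_EFinP.
Qed.

HB.instance Definition _ := Choice.on (Lp p1).
HB.instance Definition _ := EqQuotient.on (Lp p1).

Let W := LfunType mu (p1 : (1 <= p%:E)%E).
Let cls (f : W) : Lp p1 := \pi_(Lp p1) (LpFun (Lp_integrable_EFin (LfunP f))).
Let rep (q : Lp p1) : W := Lfun_Sub _ (Lp_integrable_fine (valP (repr q))).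

Let clsP (f g : W) : cls f = cls g <-> f = g %[ae mu].
Proof.
rewrite /cls; split.
  move=> /eqmodP /asboolP; apply: filterS => x /(_ Logic.I) /= [fg] _.
  exact: fg.
by move=> fg; apply/eqmodP/asboolP; apply: filterS fg => x /= /(_ Logic.I) -> _.
Qed.

Let repK : cancel rep cls.
Proof.
move=> q; rewrite -[RHS]reprK; apply/eqmodP/asboolP => /=.
by apply: filterS (Lp_integrable_fin (valP (repr q))) => x fx _ /=; rewrite fineK.
Qed.

Let clsD (f f' g g' : W) : cls f = cls f' -> cls g = cls g' ->
  cls (f + g) = cls (f' + g').
Proof.
move=> /clsP ff' /clsP gg'; apply/clsP.
apply: filterS2 ff' gg' => x /(_ Logic.I) fx /(_ Logic.I) gx _.
by change (f x + g x = f' x + g' x); rewrite fx gx.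
Qed.

Let clsZ (a : R) (f f' : W) : cls f = cls f' -> cls (a *: f) = cls (a *: f').
Proof.
move=> /clsP ff'; apply/clsP.
apply: filterS ff' => x /(_ Logic.I) fx _.
by change (a * f x = a * f' x); rewrite fx.
Qed.

HB.instance Definition _ := isLmodQuotient.Build R W (Lp p1) repK clsD clsZ.

Let normc (q : Lp p1) : R := fine 'N[mu]_(p%:E)[repr q]%E.

Let norm_cls (f : W) : normc (cls f) = fine 'N[mu]_(p%:E)[EFin \o f]%E.
Proof.
congr fine; apply: Lnorm_ae_eq.
- by have := valP (repr (cls f)); rewrite inE => -[].
- exact/measurable_EFinP.
- have /eqmodP/asboolP : repr (cls f) =
    LpFun (Lp_integrable_EFin (LfunP f)) %[mod Lp p1] by rewrite reprK.
  by [].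
Qed.

Let normD (x y : Lp p1) : normc (x + y) <= normc x + normc y.
Proof.
rewrite -[x]repK -[y]repK (_ : cls _ + cls _ = cls (rep x + rep y)).
  by rewrite !norm_cls; exact: ler_LnormD.
by apply: clsD; rewrite repK.
Qed.

Let normZ (a : R) (x : Lp p1) : normc (a *: x) = `|a| * normc x.
Proof.
rewrite -[x]repK (_ : a *: cls _ = cls (a *: rep x)); last first.
  by apply: clsZ; rewrite repK.
rewrite !norm_cls; apply/EFin_inj.
by rewrite EFinM !finite_norm_fine LnormZ.
Qed.

Let norm0_eq0 (x : Lp p1) : normc x = 0 -> x = 0.
Proof.
rewrite -[x]repK norm_cls => /fine_Lnormr_eq0 x0; apply/clsP.
by apply: filterS x0 => t /(_ Logic.I) xt _; exact: xt.
Qed.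

HB.instance Definition _ :=
  Lmodule_isNormed.Build R (Lp p1) normD normZ norm0_eq0.

Let le (x y : Lp p1) : Prop := {ae mu, forall t, (repr x t <= repr y t)%E}.

Let le_cls (f g : W) : le (cls f) (cls g) <-> {ae mu, forall t, f t <= g t}.
Proof.
have E (h : W) : (repr (cls h) : T -> \bar R) = EFin \o h %[ae mu].
  have /eqmodP/asboolP : repr (cls h) =
    LpFun (Lp_integrable_EFin (LfunP h)) %[mod Lp p1] by rewrite reprK.
  by [].
split => H.
  apply: filterS3 (E f) (E g) H => t /(_ Logic.I) -> /(_ Logic.I) ->.
  by rewrite lee_fin.
apply: filterS3 (E f) (E g) H => t /(_ Logic.I) -> /(_ Logic.I) ->.
by rewrite lee_fin.
Qed.

Let le_refl x : le x x.
Proof. exact: aeW. Qed.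

Let le_anti x y : le x y -> le y x -> x = y.
Proof.
move=> xy yx; rewrite -[x]reprK -[y]reprK; apply/eqmodP/asboolP.
by apply: filterS2 xy yx => t xy yx _; apply/le_anti; rewrite xy yx.
Qed.

Let le_trans y x z : le x y -> le y z -> le x z.
Proof. by apply: filterS2 => t; exact: le_trans. Qed.

Let leD2r (z x y : Lp p1) : le x y -> le (x + z) (y + z).
Proof.
rewrite -[x]repK -[y]repK -[z]repK => /le_cls xy.
have D (f g : W) : cls f + cls g = cls (f + g) by apply: clsD; rewrite repK.
rewrite !D; apply/le_cls; apply: filterS xy => t /=.
by rewrite lerD2r.
Qed.

Let leZ (a : R) (x y : Lp p1) : 0 <= a -> le x y -> le (a *: x) (a *: y).
Proof.
move=> a0; rewrite -[x]repK -[y]repK => /le_cls xy.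
have Z (f : W) : a *: cls f = cls (a *: f) by apply: clsZ; rewrite repK.
rewrite !Z; apply/le_cls; apply: filterS xy => t /=.
exact: ler_wpM2l.
Qed.

HB.instance Definition _ := isOrderedVectorSpace.Build R (Lp p1)
  le_refl le_anti le_trans leD2r leZ.

(* The class of [f] when [f] is in [Lp_integrable], and the class of 0 (a junk
   value) otherwise. *)
Definition Lp_class f : Lp p1 :=
  \pi_(Lp p1) (insubd (LpFun (Lp_integrable_EFin (LfunP (0 : W)))) f).

Let Lp_class_cls f (fP : f \in Lp_integrable) : exists2 h : W,
  Lp_class f = cls h & f = EFin \o h %[ae mu].
Proof.
have fh : f = EFin \o (fine \o f) %[ae mu].
  by apply: filterS (Lp_integrable_fin fP) => t ft _ /=; rewrite fineK.
exists (Lfun_Sub _ (Lp_integrable_fine fP)) => //.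
by apply/eqmodP/asboolP => /=; rewrite insubdK.
Qed.

Let Lp_class_EFin (h : W) : Lp_class (EFin \o h) = cls h.
Proof.
have hP := Lp_integrable_EFin (LfunP h).
by apply/eqmodP/asboolP => /=; rewrite insubdK//; exact: ae_eq_refl.
Qed.

Lemma Lp_class_eq f g : f \in Lp_integrable -> g \in Lp_integrable ->
  (Lp_class f = Lp_class g <-> f = g %[ae mu]).
Proof.
move=> fP gP; rewrite /Lp_class; split.
  by move=> /eqmodP/asboolP /=; rewrite !insubdK.
by move=> fg; apply/eqmodP/asboolP => /=; rewrite !insubdK.
Qed.

Lemma Lp_class_surj (q : Lp p1) : exists2 f, f \in Lp_integrable & q = Lp_class f.
Proof.
exists (repr q); first exact: valP.
rewrite -[LHS]reprK /Lp_class; congr \pi; apply/val_inj.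
by rewrite insubdK//; exact: valP.
Qed.

Lemma Lp_class_norm f : f \in Lp_integrable ->
  `|Lp_class f| = fine 'N[mu]_(p%:E)[f]%E.
Proof.
move=> fP; have [h -> fh] := Lp_class_cls fP.
rewrite [LHS]norm_cls; congr fine; apply/esym/Lnorm_ae_eq => //.
- by move: fP; rewrite inE => -[].
- exact/measurable_EFinP.
Qed.

Lemma Lp_class_le f g : f \in Lp_integrable -> g \in Lp_integrable ->
  (Lp_class f ≼ Lp_class g <-> {ae mu, forall t, (f t <= g t)%E}).
Proof.
move=> /Lp_class_cls[h -> fh] /Lp_class_cls[k -> gk]; split.
  move=> /le_cls; apply: filterS3 fh gk => t /(_ Logic.I) -> /(_ Logic.I) ->.
  by rewrite lee_fin.
move=> fg; apply/le_cls.
apply: filterS3 fh gk fg => t /(_ Logic.I) -> /(_ Logic.I) ->.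
by rewrite lee_fin.
Qed.

Lemma Lp_classD (f g : T -> R) : f \in Lfun mu p%:E -> g \in Lfun mu p%:E ->
  Lp_class (EFin \o (f \+ g)) = Lp_class (EFin \o f) + Lp_class (EFin \o g).
Proof.
move=> fP gP; rewrite -(Lfun_valP (p1 : (1 <= p%:E)%E) fP).
rewrite -(Lfun_valP (p1 : (1 <= p%:E)%E) gP).
move: (Lfun_Sub _ fP) (Lfun_Sub _ gP) => h k.
rewrite -[X in Lp_class X = _]/(EFin \o (h + k : W)) !Lp_class_EFin.
by apply: clsD; rewrite repK.
Qed.

Lemma Lp_classZ a (f : T -> R) : f \in Lfun mu p%:E ->
  Lp_class (EFin \o (a \*: f)) = a *: Lp_class (EFin \o f).
Proof.
move=> fP; rewrite -(Lfun_valP (p1 : (1 <= p%:E)%E) fP); move: (Lfun_Sub _ fP) => h.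
rewrite -[X in Lp_class X = _]/(EFin \o (a *: h : W)) !Lp_class_EFin.
by apply: clsZ; rewrite repK.
Qed.

End Lp_ge1.

End Lp.

Section vector_lattice.
Context (R : realType).

Definition seminorm (V : lmodType R) (N : V -> R) :=
  (forall x y, N (x + y) <= N x + N y) /\ forall a x, N (a *: x) = `|a| * N x.

Section order.
Variable E : orderedVectorType R.
Implicit Types (A : set E) (x y z : E).

Definition is_sup A z := (forall x, A x -> x ≼ z) /\
  forall w, (forall x, A x -> x ≼ w) -> z ≼ w.

Definition is_inf A z := (forall x, A x -> z ≼ x) /\
  forall w, (forall x, A x -> w ≼ x) -> w ≼ z.

Definition is_modulus x z := is_sup [set x; - x] z.

Definition vector_lattice := forall x y, exists z, is_sup [set x; y] z.

Definition lattice_seminorm (N : E -> R) := seminorm N /\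
  forall x y ax ay, is_modulus x ax -> is_modulus y ay -> ax ≼ ay -> N x <= N y.

Definition disjoint_elements x y := forall ax ay,
  is_modulus x ax -> is_modulus y ay -> is_inf [set ax; ay] 0.

Definition disjoint_complement A := [set x | forall y, A y -> disjoint_elements x y].

Definition order_ideal A :=
  [/\ A 0, forall x y, A x -> A y -> A (x + y), forall a x, A x -> A (a *: x) &
      forall x y ax ay, is_modulus x ax -> is_modulus y ay -> ax ≼ ay ->
        A y -> A x].

Definition band A :=
  order_ideal A /\ forall D z, D `<=` A -> is_sup D z -> A z.

Definition projection_band A := band A /\
  forall x, exists y z, [/\ A y, disjoint_complement A z & x = y + z].

End order.

Definition lattice_hom (E F : orderedVectorType R) (f : E -> F) :=
  linear f /\ forall x y z, is_sup [set x; y] z -> is_sup [set f x; f y] (f z).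

Definition banach (E : normedModType R) :=
  forall F : set_system E, ProperFilter F -> cauchy F -> cvg F.

Definition banach_lattice (E : orderedNormedType R) :=
  [/\ vector_lattice E, lattice_seminorm (fun x : E => `|x|) & banach E].

Definition isometric_lattice_iso (E F : orderedNormedType R) (f : E -> F) :=
  [/\ lattice_hom f, bijective f & forall x, `|f x| = `|x|].

Definition bounded_operator (E : normedModType R) (T : E -> E) :=
  linear T /\ exists M, forall x, `|T x| <= M * `|x|.

Definition operator_norm (E : normedModType R) (T : E -> E) : R :=
  sup [set `|T x| | x in [set x : E | `|x| <= 1]].

Definition representation (G : groupType) (E : normedModType R)
    (rho : G -> E -> E) :=
  [/\ forall g, bounded_operator (rho g), rho 1%g = id &
      forall g h, rho (g * h)%g = rho g \o rho h].

Definition isometric_lattice_representation (G : groupType)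
    (E : orderedNormedType R) (rho : G -> E -> E) :=
  representation rho /\ forall g, isometric_lattice_iso (rho g).

Definition order_indecomposable (G : groupType) (E : orderedVectorType R)
    (rho : G -> E -> E) :=
  forall A : set E, projection_band A -> (forall g, rho g @` A `<=` A) ->
    A = [set 0] \/ A = setT.

(* [B] is the completion of the quotient of [V] by the kernel of [N], and [i] is
   the class map: since [`|i x| = N x], [i] factors through an isometric
   embedding of the quotient, and its range is dense in the complete space [B].
   In the lattice case below, [i] being moreover a lattice homomorphism
   determines the order of [B]: its positive cone is the closure of the image
   under [i] of the positive cone of [V]. *)
Definition completion (V : lmodType R) (N : V -> R) (B : normedModType R)
    (i : V -> B) :=
  [/\ banach B, linear i, forall x, `|i x| = N x & dense (range i)].

End vector_lattice.

Section families.
Context d (Omega : measurableType d) (R : realType).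

Definition measurable_seminorms (V : lmodType R) (N : Omega -> V -> R) :=
  (forall w, seminorm (N w)) /\ forall x, measurable_fun setT (N ^~ x).

Definition measurable_banach_family (V : lmodType R) (N : Omega -> V -> R)
    (B : Omega -> normedModType R) (i : forall w, V -> B w) :=
  measurable_seminorms N /\ forall w, completion (N w) (i w).

Definition measurable_banach_lattice_family (V : orderedVectorType R)
    (N : Omega -> V -> R) (B : Omega -> orderedNormedType R)
    (i : forall w, V -> B w) :=
  [/\ measurable_banach_family N i,
      vector_lattice V,
      forall w, lattice_seminorm (N w),
      forall w, banach_lattice (B w) &
      forall w, lattice_hom (i w)].

Record banach_lattice_family (V : orderedVectorType R) := BanachLatticeFamily {
  family_seminorm : Omega -> V -> R;
  fiber :> Omega -> orderedNormedType R;
  family_class : forall w, V -> fiber w;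
  familyP : measurable_banach_lattice_family family_seminorm family_class
}.

End families.

Section sections.
Context d (Omega : measurableType d) (R : realType) (V : orderedVectorType R).
Variable F : banach_lattice_family Omega V.

Definition section := forall w, F w.

Implicit Types s t : section.

HB.instance Definition _ := gen_eqMixin section.
HB.instance Definition _ := gen_choiceMixin section.

Let sadd s t : section := fun w => s w + t w.
Let sopp s : section := fun w => - s w.
Let szero : section := fun w => 0.
Let sscale (a : R) s : section := fun w => a *: s w.

Let saddA : associative sadd.
Proof. by move=> s t u; apply: functional_extensionality_dep => w; exact: addrA. Qed.

Let saddC : commutative sadd.
Proof. by move=> s t; apply: functional_extensionality_dep => w; exact: addrC. Qed.

Let sadd0 : left_id szero sadd.
Proof. by move=> s; apply: functional_extensionality_dep => w; exact: add0r. Qed.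

Let saddN : left_inverse szero sopp sadd.
Proof. by move=> s; apply: functional_extensionality_dep => w; exact: addNr. Qed.

HB.instance Definition _ := GRing.isZmodule.Build section saddA saddC sadd0 saddN.

Let sscaleA a b s : sscale a (sscale b s) = sscale (a * b) s.
Proof. by apply: functional_extensionality_dep => w; exact: scalerA. Qed.

Let sscale1 : left_id 1 sscale.
Proof. by move=> s; apply: functional_extensionality_dep => w; exact: scale1r. Qed.

Let sscaleDr : right_distributive sscale +%R.
Proof. by move=> a s t; apply: functional_extensionality_dep => w; exact: scalerDr. Qed.

Let sscaleDl s : {morph sscale^~ s : a b / a + b}.
Proof. by move=> a b; apply: functional_extensionality_dep => w; exact: scalerDl. Qed.

HB.instance Definition _ :=
  GRing.Zmodule_isLmodule.Build R section sscaleA sscale1 sscaleDr sscaleDl.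

Definition simple_section s := exists2 l : seq (set Omega * V),
  (forall Ax, Ax \in l -> measurable Ax.1) &
  forall w, s w = family_class F w (\sum_(Ax <- l) \1_(Ax.1) w *: Ax.2).

Definition measurable_section s := exists2 s_ : nat -> section,
  (forall k, simple_section (s_ k)) & forall w, s_ k w @[k --> \oo] --> s w.

End sections.

Section direct_integral.
Context d (Omega : measurableType d) (R : realType) (V : orderedVectorType R).
Variables (F : banach_lattice_family Omega V).
Variables (nu : {measure set Omega -> \bar R}) (p : R).
Implicit Types s t : section F.

Let classD w x y : family_class F w (x + y) = family_class F w x + family_class F w y.
Proof. by have [[_ /(_ w)[_ + _ _]]] := familyP F => /(_ 1 x y); rewrite !scale1r. Qed.

Let classZ w a x : family_class F w (a *: x) = a *: family_class F w x.
Proof.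
have [[_ /(_ w)[_ L _ _]]] := familyP F => _ _ _ _.
have c0 : family_class F w 0 = 0.
  by have /eqP := classD w 0 0; rewrite addr0 addrC -subr_eq subrr eq_sym => /eqP.
by have := L a x 0; rewrite !addr0 c0 addr0.
Qed.

Let measurable_section0 : measurable_section (0 : section F).
Proof.
exists (fun _ => 0) => [k|w]; last exact: cvg_cst.
exists [::] => // w; rewrite big_nil.
by have := classZ w 0 0; rewrite !scale0r => ->.
Qed.

Let measurable_sectionD s t :
  measurable_section s -> measurable_section t -> measurable_section (s + t).
Proof.
move=> [s_ ss sl] [t_ st tl]; exists (fun k => s_ k + t_ k) => [k|w]; last first.
  exact: (cvgD (sl w) (tl w)).
have [l lm sE] := ss k; have [m mm tE] := st k.
exists (l ++ m) => [Ax|w].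
  by rewrite mem_cat => /orP[/lm|/mm].
by rewrite big_cat/= classD -sE -tE.
Qed.

Let measurable_sectionZ (a : R) s :
  measurable_section s -> measurable_section (a *: s).
Proof.
move=> [s_ ss sl]; exists (fun k => a *: s_ k) => [k|w]; last first.
  exact: (cvgZl_tmp (sl w)).
have [l lm sE] := ss k.
exists [seq (Ax.1, a *: Ax.2) | Ax <- l] => [Ax /mapP[By lBy ->]|w].
  exact: (lm By).
rewrite big_map/= [LHS](_ : _ = a *: s_ k w)// sE -classZ scaler_sumr.
by congr family_class; apply: eq_bigr => Ax _; rewrite !scalerA mulrC.
Qed.

Lemma measurable_section_norm s : measurable_section s ->
  measurable_fun setT (fun w => `|s w|).
Proof.
move=> [s_ ss sl]; apply: (@measurable_fun_cvg _ _ _ _ (fun k w => `|s_ k w|)).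
  move=> k; have [l lm sE] := ss k.
  have [[[_ mN] /= cN] _ _ _ _] := familyP F.
  under eq_fun => w do rewrite sE (let: And4 _ _ e _ := cN w in e).
  suff H x : measurable_fun setT (fun w =>
      family_seminorm F w (x + \sum_(Ax <- l) \1_(Ax.1) w *: Ax.2)).
    by have := H 0; under eq_fun do rewrite add0r.
  elim: l lm {sE} x => [|[A y] l IHl] lm x.
    by under eq_fun do rewrite big_nil; exact: mN.
  have {}IHl := IHl (fun Ax h => lm Ax (mem_behead (s := (A, y) :: l) h)).
  have mA : measurable A by apply: (lm (A, y)); rewrite mem_head.
  rewrite (_ : (fun w => _) = (fun w => if w \in A
      then family_seminorm F w ((x + y) + \sum_(Ax <- l) \1_(Ax.1) w *: Ax.2)
      else family_seminorm F w (x + \sum_(Ax <- l) \1_(Ax.1) w *: Ax.2))).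
    apply: measurable_fun_ifT => //; apply: (measurable_fun_bool true).
    rewrite setTI (_ : _ @^-1` _ = A)//.
    by apply/seteqP; split => w /=; [move/set_mem|move/mem_set].
  apply/funext => w; rewrite big_cons/= indicE; case: (w \in A).
    by rewrite scale1r addrA.
  by rewrite scale0r add0r.
by move=> w _; apply: cvg_norm; exact: sl.
Qed.

Definition Lp_section : {pred section F} := mem [set s |
  measurable_section s /\ (\int[nu]_w (`|s w| `^ p)%:E < +oo)%E].

Section ge1.
Hypothesis p1 : 1 <= p.

Let p0 : 0 < p. Proof. exact: lt_le_trans p1. Qed.

Let pE : (1 <= p%:E)%E. Proof. exact: p1. Qed.

Let LnormE s : ('N[nu]_(p%:E)[EFin \o (fun w => `|s w|%R)] =
  (\int[nu]_w (`|s w| `^ p)%:E) `^ p^-1)%E.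
Proof.
rewrite unlock /Lnorm; congr (_ `^ _)%E; apply: eq_integral => w _ /=.
by rewrite normr_id.
Qed.

Let Lp_sectionP s : s \in Lp_section <-> measurable_section s /\
  ('N[nu]_(p%:E)[EFin \o (fun w => `|s w|%R)] < +oo)%E.
Proof.
rewrite inE LnormE; split => -[ms sy]; split=> //; first exact: poweR_lty.
by move: sy; apply: lty_poweRy; rewrite invr_neq0// gt_eqF.
Qed.

Let Lp_section_Lfun s : s \in Lp_section -> (fun w => `|s w|) \in Lfun nu p%:E.
Proof.
move=> /Lp_sectionP[ms sy]; rewrite inE; apply/andP; split; rewrite inE//=.
exact: measurable_section_norm.
Qed.

Let Lnorm_le (f g : Omega -> R) : measurable_fun setT f -> measurable_fun setT g ->
  (forall w, 0 <= f w) -> (forall w, f w <= g w) ->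
  ('N[nu]_(p%:E)[EFin \o f] <= 'N[nu]_(p%:E)[EFin \o g])%E.
Proof.
move=> mf mg f0 fg; rewrite unlock /Lnorm gt0_ler_poweR ?invr_ge0 ?(ltW p0)//.
- by rewrite in_itv/= leey integral_ge0// => w _; exact: poweR_ge0.
- by rewrite in_itv/= leey integral_ge0// => w _; exact: poweR_ge0.
apply: ge0_le_integral => //.
- by move=> w _; exact: poweR_ge0.
- apply/(measurableT_comp (measurable_poweR p))/measurableT_comp => //.
  exact/measurable_EFinP.
- apply/(measurableT_comp (measurable_poweR p))/measurableT_comp => //.
  exact/measurable_EFinP.
move=> w _ /=; rewrite lee_fin ge0_ler_powR ?(ltW p0)// ?nnegrE//.
by rewrite !ger0_norm// (le_trans (f0 w)).
Qed.

Let LnormD s t : measurable_section s -> measurable_section t ->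
  ('N[nu]_(p%:E)[EFin \o (fun w => `|(s + t) w|%R)] <=
   'N[nu]_(p%:E)[EFin \o (fun w => `|s w|%R)] +
   'N[nu]_(p%:E)[EFin \o (fun w => `|t w|%R)])%E.
Proof.
move=> ms mt; have mns := measurable_section_norm ms.
have mnt := measurable_section_norm mt.
apply: le_trans (eminkowski nu mns mnt pE); apply: Lnorm_le => //.
- exact/measurable_section_norm/measurable_sectionD.
- exact: measurable_funD.
- by move=> w; exact: ler_normD.
Qed.

Let LnormZ (a : R) s : s \in Lp_section ->
  ('N[nu]_(p%:E)[EFin \o (fun w => `|(a *: s) w|%R)] =
   `|a|%:E * 'N[nu]_(p%:E)[EFin \o (fun w => `|s w|%R)])%E.
Proof.
move=> sP; have := LnormZ (Lfun_Sub pE (Lp_section_Lfun sP)) `|a|; rewrite normr_id => <-.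
congr (Lnorm _ _ _); apply/funext => w /=; congr EFin.
exact: normrZ.
Qed.

Lemma Lp_section_submod_closed : submod_closed Lp_section.
Proof.
have Z (a : R) s : s \in Lp_section -> a *: s \in Lp_section.
  move=> sP; have /Lp_sectionP[ms sy] := sP.
  apply/Lp_sectionP; split; first exact: measurable_sectionZ.
  by rewrite LnormZ// lte_mul_pinfty// lee_fin.
split=> [|a s t /(Z a)/Lp_sectionP[ms sy] /Lp_sectionP[mt ty]].
  apply/Lp_sectionP; split=> //.
  rewrite (_ : (fun w => _) = cst 0); last by apply/funext => w; exact: normr0.
  by rewrite Lnorm0// eqe gt_eqF.
apply/Lp_sectionP; split; first exact: measurable_sectionD.
exact: le_lt_trans (LnormD ms mt) (lte_add_pinfty sy ty).
Qed.

HB.instance Definition _ :=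
  GRing.isSubmodClosed.Build _ _ Lp_section Lp_section_submod_closed.

Record Lp_sections := LpSections {
  Lp_sections_val : section F; _ : Lp_sections_val \in Lp_section }.

Definition Lp_sections_fun (s : Lp_sections) : forall w, F w := Lp_sections_val s.

Coercion Lp_sections_fun : Lp_sections >-> Funclass.

HB.instance Definition _ := [isSub for Lp_sections_val].
HB.instance Definition _ := gen_eqMixin Lp_sections.
HB.instance Definition _ := gen_choiceMixin Lp_sections.
HB.instance Definition _ := [SubChoice_isSubLmodule of Lp_sections by <:].

Local Open Scope quotient_scope.

Definition section_eq (s t : Lp_sections) :=
  `[< {ae nu, forall w, s w = t w} >].

Let section_eq_refl : reflexive section_eq.
Proof. by move=> s; apply/asboolP/aeW. Qed.

Let section_eq_sym : symmetric section_eq.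
Proof.
by move=> s t; apply/idP/idP => /asboolP st; apply/asboolP; apply: filterS st.
Qed.

Let section_eq_trans : transitive section_eq.
Proof.
move=> s t u /asboolP st /asboolP tu; apply/asboolP.
by apply: filterS2 st tu => w -> ->.
Qed.

Canonical section_equiv :=
  EquivRel section_eq section_eq_refl section_eq_sym section_eq_trans.

Definition Lp_direct_integral (_ : 1 <= p) : Type := {eq_quot section_eq}.

Local Notation DI := (Lp_direct_integral p1).

HB.instance Definition _ := Choice.on DI.
HB.instance Definition _ := EqQuotient.on DI.

Let cls (s : Lp_sections) : DI := \pi_DI s.

Let clsP (s t : Lp_sections) : cls s = cls t <-> {ae nu, forall w, s w = t w}.
Proof. by split=> [/eqmodP/asboolP|st]//; apply/eqmodP/asboolP. Qed.

Let repK : cancel (repr : DI -> Lp_sections) cls.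
Proof. exact: reprK. Qed.

Let clsD (s s' t t' : Lp_sections) : cls s = cls s' -> cls t = cls t' ->
  cls (s + t) = cls (s' + t').
Proof.
move=> /clsP ss' /clsP tt'; apply/clsP; apply: filterS2 ss' tt' => w sw tw.
by change (s w + t w = s' w + t' w); rewrite sw tw.
Qed.

Let clsZ (a : R) (s s' : Lp_sections) : cls s = cls s' ->
  cls (a *: s) = cls (a *: s').
Proof.
move=> /clsP ss'; apply/clsP; apply: filterS ss' => w sw.
by change (a *: s w = a *: s' w); rewrite sw.
Qed.

HB.instance Definition _ := isLmodQuotient.Build R Lp_sections DI repK clsD clsZ.

Let normc (q : DI) : R := fine ((\int[nu]_w (`|repr q w| `^ p)%:E) `^ p^-1)%E.

Let norm_ae (s t : Lp_sections) : {ae nu, forall w, s w = t w} ->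
  (\int[nu]_w (`|s w| `^ p)%:E = \int[nu]_w (`|t w| `^ p)%:E)%E.
Proof.
have mn (u : Lp_sections) : measurable_fun setT (fun w => (`|u w| `^ p)%:E).
  apply/measurable_EFinP/(measurableT_comp (measurable_powR p)).
  by apply: measurable_section_norm; have /Lp_sectionP[] := valP u.
move=> st; apply: ae_eq_integral => //.
by apply: filterS st => w -> _.
Qed.

Let norm_cls (s : Lp_sections) :
  normc (cls s) = fine ((\int[nu]_w (`|s w| `^ p)%:E) `^ p^-1)%E.
Proof. by congr (fine (_ `^ _)%E); apply: norm_ae; apply/clsP; exact: repK. Qed.

Let normE (s : Lp_sections) : (normc (cls s))%:E =
  ('N[nu]_(p%:E)[EFin \o (fun w => `|s w|%R)])%E.
Proof.
rewrite norm_cls LnormE fineK// ge0_fin_numE ?poweR_ge0//.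
by have /Lp_sectionP[] := valP s; rewrite LnormE.
Qed.

Let normD (x y : DI) : normc (x + y) <= normc x + normc y.
Proof.
rewrite -[x]repK -[y]repK (_ : cls _ + cls _ = cls (repr x + repr y)).
  rewrite -lee_fin EFinD !normE; apply: LnormD.
  - by have /Lp_sectionP[] := valP (repr x).
  - by have /Lp_sectionP[] := valP (repr y).
by apply: clsD; exact: repK.
Qed.

Let normZ (a : R) (x : DI) : normc (a *: x) = `|a| * normc x.
Proof.
rewrite -[x]repK (_ : a *: cls _ = cls (a *: repr x)); last first.
  by apply: clsZ; exact: repK.
by apply/EFin_inj; rewrite EFinM !normE; exact: LnormZ (valP (repr x)).
Qed.

Let norm0_eq0 (x : DI) : normc x = 0 -> x = 0.
Proof.
rewrite -[x]repK => x0; have /Lp_sectionP[ms _] := valP (repr x).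
have mf : measurable_fun setT (EFin \o (fun w => `|repr x w|%R)).
  exact/measurable_EFinP/measurable_section_norm.
have p0E : (0 < p%:E)%E by rewrite lte_fin.
have /(Lnorm_eq0_eq0 mf p0E) xae :
  ('N[nu]_(p%:E)[EFin \o (fun w => `|repr x w|%R)] = 0)%E by rewrite -normE x0.
apply/clsP; apply: filterS xae => w /(_ Logic.I) [] /eqP.
by rewrite normr_eq0 => /eqP.
Qed.

HB.instance Definition _ :=
  Lmodule_isNormed.Build R DI normD normZ norm0_eq0.

Let le (x y : DI) : Prop := {ae nu, forall w, repr x w ≼ repr y w}.

Let le_cls (s t : Lp_sections) :
  le (cls s) (cls t) <-> {ae nu, forall w, s w ≼ t w}.
Proof.
have E (u : Lp_sections) : {ae nu, forall w, repr (cls u) w = u w}.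
  by apply/clsP; exact: repK.
by split=> H; apply: filterS3 (E s) (E t) H => w -> ->.
Qed.

Let le_refl x : le x x.
Proof. by apply: aeW => w; exact: vle_refl. Qed.

Let le_anti x y : le x y -> le y x -> x = y.
Proof.
move=> xy yx; rewrite -[x]repK -[y]repK; apply/clsP.
by apply: filterS2 xy yx => w; exact: vle_anti.
Qed.

Let le_trans y x z : le x y -> le y z -> le x z.
Proof. by apply: filterS2 => w; exact: vle_trans. Qed.

Let leD2r (z x y : DI) : le x y -> le (x + z) (y + z).
Proof.
rewrite -[x]repK -[y]repK -[z]repK => /le_cls xy.
have D (s t : Lp_sections) : cls s + cls t = cls (s + t).
  by apply: clsD; exact: repK.
by rewrite !D; apply/le_cls; apply: filterS xy => w; exact: vleD2r.
Qed.

Let leZ (a : R) (x y : DI) : 0 <= a -> le x y -> le (a *: x) (a *: y).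
Proof.
move=> a0; rewrite -[x]repK -[y]repK => /le_cls xy.
have Z (s : Lp_sections) : a *: cls s = cls (a *: s).
  by apply: clsZ; exact: repK.
by rewrite !Z; apply/le_cls; apply: filterS xy => w; exact: vleZ.
Qed.

HB.instance Definition _ := isOrderedVectorSpace.Build R DI
  le_refl le_anti le_trans leD2r leZ.

(* The class of [s] when [s] is in [Lp_section], and 0 (a junk value) otherwise. *)
Definition section_class s : DI := \pi_DI (insubd (0 : Lp_sections) s).

Let section_class_cls s (sP : s \in Lp_section) :
  section_class s = cls (LpSections sP).
Proof. by congr \pi; apply/val_inj; rewrite insubdK. Qed.

Lemma section_class_eq s t : s \in Lp_section -> t \in Lp_section ->
  (section_class s = section_class t <-> {ae nu, forall w, s w = t w}).
Proof. by move=> sP tP; rewrite !section_class_cls. Qed.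

Lemma section_class_surj (q : DI) :
  exists2 s, s \in Lp_section & q = section_class s.
Proof.
exists (repr q); first exact: valP.
rewrite -[LHS]reprK /section_class; congr \pi; apply/val_inj.
by rewrite insubdK//; exact: valP.
Qed.

Lemma section_class_norm s : s \in Lp_section ->
  `|section_class s| = fine ((\int[nu]_w (`|s w| `^ p)%:E) `^ p^-1)%E.
Proof. by move=> sP; rewrite section_class_cls; exact: norm_cls. Qed.

Lemma section_class_le s t : s \in Lp_section -> t \in Lp_section ->
  (section_class s ≼ section_class t <-> {ae nu, forall w, s w ≼ t w}).
Proof. by move=> sP tP; rewrite !section_class_cls; exact: le_cls. Qed.

Lemma section_classD s t : s \in Lp_section -> t \in Lp_section ->
  section_class (s + t) = section_class s + section_class t.
Proof.
move=> sP tP; have stP : s + t \in Lp_section by exact: rpredD.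
rewrite !section_class_cls.
transitivity (cls (LpSections sP + LpSections tP)).
  by congr cls; exact/val_inj.
by apply: clsD; exact/esym/repK.
Qed.

Lemma section_classZ (a : R) s : s \in Lp_section ->
  section_class (a *: s) = a *: section_class s.
Proof.
move=> sP; have asP : a *: s \in Lp_section by exact: rpredZ.
rewrite !section_class_cls; transitivity (cls (a *: LpSections sP)).
  by congr cls; exact/val_inj.
by apply: clsZ; exact/esym/repK.
Qed.

End ge1.
End direct_integral.

Arguments Lp_section {d Omega R V} F nu p.
Arguments section_class {d Omega R V} F nu {p} p1 s.

Section decomposable.
Context d (Omega : measurableType d) (R : realType) (V : orderedVectorType R).
Variables (F : banach_lattice_family Omega V).
Variables (nu : {measure set Omega -> \bar R}) (p : R) (p1 : 1 <= p).

Definition decomposable_operator (T : forall w, F w -> F w) :=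
  [/\ forall w, bounded_operator (T w),
      forall s : section F, measurable_section s ->
        measurable_section ((fun w => T w (s w)) : section F) &
      exists M, {ae nu, forall w, operator_norm (T w) <= M}].

(* Only meaningful if [T] is decomposable. *)
Definition integral_operator (T : forall w, F w -> F w)
    (q : Lp_direct_integral F nu p1) : Lp_direct_integral F nu p1 :=
  section_class F nu p1 (fun w => T w (repr q w)).

Definition decomposable_representation (G : groupType)
    (rho : forall w, G -> F w -> F w) :=
  (forall w, representation (rho w)) /\
  forall g, decomposable_operator (fun w => rho w g).

(* Independence of the representative used in [integral_operator]. *)
Definition integral_operator_well_defined (T : forall w, F w -> F w) :=
  forall s, s \in Lp_section F nu p ->
    ((fun w => T w (s w)) : section F) \in Lp_section F nu p /\
    integral_operator T (section_class F nu p1 s) =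
    section_class F nu p1 (fun w => T w (s w)).

End decomposable.
Arguments decomposable_operator {d Omega R V} F nu T.
Arguments integral_operator {d Omega R V} F nu {p} p1 T q.
Arguments integral_operator_well_defined {d Omega R V} F nu {p} p1 T.
Arguments decomposable_representation {d Omega R V} F nu {G} rho.

Section simple_functions.
Context d (T : measurableType d) (R : realType).

Let sfun_scaler_closed : scaler_closed (@sfun _ T R).
Proof.
move=> a f /andP[mf]; rewrite inE => ff.
apply/andP; split; first exact: rpredZ.
rewrite inE; have := finite_image ( *%R a) ff.
by rewrite image_comp.
Qed.

HB.instance Definition _ :=
  GRing.isScaleClosed.Build _ _ (@sfun _ T R) sfun_scaler_closed.

HB.instance Definition _ := [SubZmodule_isSubLmodule of {sfun T >-> R} by <:].

Let le (f g : {sfun T >-> R}) : Prop := forall x, f x <= g x.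

Let le_refl f : le f f.
Proof. by move=> x. Qed.

Let le_anti f g : le f g -> le g f -> f = g.
Proof. by move=> fg gf; apply/sfuneqP => x; apply/le_anti; rewrite fg gf. Qed.

Let le_trans g f h : le f g -> le g h -> le f h.
Proof. by move=> fg gh x; exact: le_trans (gh x). Qed.

Let leD2r (h f g : {sfun T >-> R}) : le f g -> le (f + h) (g + h).
Proof. by move=> fg x; change (f x + h x <= g x + h x); rewrite lerD2r. Qed.

Let leZ (a : R) (f g : {sfun T >-> R}) : 0 <= a -> le f g -> le (a *: f) (a *: g).
Proof. by move=> a0 fg x; change (a * f x <= a * g x); exact: ler_wpM2l. Qed.

HB.instance Definition _ := isOrderedVectorSpace.Build R {sfun T >-> R}
  le_refl le_anti le_trans leD2r leZ.

End simple_functions.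

HB.mixin Record isTopologicalGroup G & Group G & Topological G := {
  mulg_continuous : continuous (fun xy : G * G => (xy.1 * xy.2)%g);
  invg_continuous : continuous (fun x : G => x^-1%g)
}.

#[short(type="topologicalGroupType")]
HB.structure Definition TopologicalGroup :=
  {G of Group G & Topological G & isTopologicalGroup G}.

Definition completely_metrizable (R : realType) (T : topologicalType) :=
  exists dist : T -> T -> R,
    [/\ [/\ forall x y, dist x y = 0 <-> x = y,
             forall x y, dist x y = dist y x &
             forall y x z, dist x z <= dist x y + dist y z],
        forall x (A : set T),
          nbhs x A <-> exists2 e : R, 0 < e & [set y | dist x y < e] `<=` A &
        forall u : nat -> T,
          (forall e : R, 0 < e -> exists N, forall m n, (N <= m)%N -> (N <= n)%N ->
             dist (u m) (u n) < e) ->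
          exists x : T, u @ \oo --> x].

Definition polish (R : realType) (T : topologicalType) :=
  (exists2 D : set T, countable D & dense D) /\ completely_metrizable R T.

Definition continuous_action (G : topologicalGroupType) (X : topologicalType)
    (act : G -> X -> X) :=
  [/\ forall x, act 1%g x = x,
      forall g h x, act (g * h)%g x = act g (act h x) &
      continuous (fun gx : G * X => act gx.1 gx.2)].

Definition borel (T : ptopologicalType) := g_sigma_algebraType (@open T).

Lemma probability_ext d (T : measurableType d) (R : realType)
    (l m : probability T R) : (l : set T -> \bar R) = m -> l = m.
Proof.
destruct l as [l [[l1 l2] [l3] [l4] [l5] [l6] [l7] [l8]]].
destruct m as [m [[m1 m2] [m3] [m4] [m5] [m6] [m7] [m8]]].
rewrite /= => lm; subst m.
rewrite (Prop_irrelevance m1 l1); rewrite (Prop_irrelevance m2 l2).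
by congr Probability.Pack; congr Probability.Class;
  try (congr Content_isMeasure.Axioms_ || congr isSFinite.Axioms_ ||
       congr isFinite.Axioms_ || congr isSigmaFinite.Axioms_ ||
       congr isSubProbability.Axioms_ || congr isProbability.Axioms_);
  exact: Prop_irrelevance.
Qed.

Section ergodic_measures.
Context (R : realType) (G : groupType) (X : ptopologicalType).
Variable act : G -> X -> X.

Definition invariant_measure (m : set (borel X) -> \bar R) :=
  forall g (Y : set (borel X)), measurable Y -> m (act g @` Y) = m Y.

(* The library's measures are functions on all subsets of [X]. The value 0 is
   imposed on nonmeasurable sets so that, as for measures on the Borel sets, two
   ergodic measures that agree on Borel sets are equal. *)
Record ergodic_measure := ErgodicMeasure {
  ergodic_prob :> probability (borel X) R;
  ergodic_invariant : invariant_measure ergodic_prob;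
  ergodic_trivial : forall Y : set (borel X), measurable Y ->
    (forall g, ergodic_prob ((act g @` Y) `+` Y) = 0) ->
    ergodic_prob Y = 0 \/ ergodic_prob Y = 1%E;
  ergodic_nonmeasurable : forall Y : set (borel X), ~ measurable Y ->
    ergodic_prob Y = 0
}.

HB.instance Definition _ := gen_eqMixin ergodic_measure.
HB.instance Definition _ := gen_choiceMixin ergodic_measure.

(* The coarsest topology for which the integrals of bounded continuous functions
   are continuous. *)
HB.instance Definition _ := @isSubBaseTopological.Build ergodic_measure
  ((X -> R) * set R)%type
  [set hU : (X -> R) * set R | [/\ continuous hU.1,
     exists M, forall x, `|hU.1 x| <= M & open hU.2]]
  (fun hU => [set lambda : ergodic_measure |
     hU.2 (\int[lambda]_x (hU.1 x))]).

Lemma ergodic_measure_ext (l m : ergodic_measure) :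
  (forall Y : set (borel X), measurable Y -> l Y = m Y) -> l = m.
Proof.
move=> lm; have {}lm : (l : set (borel X) -> \bar R) = m.
  apply/funext => Y; have [/lm//|nY] := pselect (measurable Y).
  by rewrite !ergodic_nonmeasurable.
case: l m lm => [l l1 l2 l3] [m m1 m2 m3] /= /probability_ext lm; subst m.
by congr ErgodicMeasure; exact: Prop_irrelevance.
Qed.

(* Measurable types are pointed: [e0] is a chosen point of the nonempty space of
   ergodic measures. *)
Definition ergodic_space (_ : ergodic_measure) : Type := ergodic_measure.

HB.instance Definition _ e0 := Topological.on (ergodic_space e0).
HB.instance Definition _ e0 := isPointed.Build (ergodic_space e0) e0.

Definition decomposition_map (beta : X -> ergodic_measure) :=
  [/\ forall g x, beta (act g x) = beta x,
      forall l : ergodic_measure, l (beta @^-1` [set l]) = 1%E &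
      forall m : probability (borel X) R, invariant_measure m ->
        forall Y : set (borel X), measurable Y -> m Y = (\int[m]_x beta x Y)%E].

End ergodic_measures.

Section Lp_dynamics.
Context (R : realType) (G : groupType) (X : ptopologicalType).
Variables (act : G -> X -> X) (p : R) (p1 : 1 <= p).

Definition translate (g : G) (f : X -> \bar R) : X -> \bar R :=
  fun x => f (act g^-1%g x).

Definition canonical_representation (l : {measure set (borel X) -> \bar R})
    (g : G) (q : Lp l p1) : Lp l p1 := Lp_class l p1 (translate g (repr q)).

(* Independence of the representative used in [canonical_representation]. *)
Definition canonical_well_defined (l : {measure set (borel X) -> \bar R}) :=
  forall g f, f \in Lp_integrable l p -> translate g f \in Lp_integrable l p /\
    canonical_representation g (Lp_class l p1 f) = Lp_class l p1 (translate g f).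

Definition simple_seminorm (l : ergodic_measure R act)
    (f : {sfun borel X >-> R}) : R := fine 'N[l]_(p%:E)[EFin \o f]%E.

Definition simple_class (l : ergodic_measure R act)
    (f : {sfun borel X >-> R}) : Lp l p1 := Lp_class l p1 (EFin \o f).

Definition disintegrated_section (f : X -> \bar R) (l : ergodic_measure R act) :
  Lp l p1 := if f \in Lp_integrable l p then Lp_class l p1 f else 0.

End Lp_dynamics.
Arguments canonical_representation {R G X} act {p} p1 l g q.
Arguments simple_seminorm {R G X act} p l f.
Arguments simple_class {R G X act p} p1 l f.

(* Main.v *)
Require Import Defs.
From HB Require Import structures.
From mathcomp Require Import all_boot all_order all_algebra.
From mathcomp Require Import all_classical all_reals all_analysis.
From mathcomp Require Import measurable_realfun giry lra.

Set Implicit Arguments.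
Unset Strict Implicit.
Unset Printing Implicit Defensive.

Import Order.TTheory GRing.Theory Num.Theory.
Import numFieldNormedType.Exports.

Local Open Scope classical_set_scope.
Local Open Scope ring_scope.

(** The third property of the decomposition map, read through the push-forward
    [nu], says that [mu] is the mixture of the ergodic measures [l] with
    respect to [nu]: the integral of [h >= 0] against [mu] is the [nu]-integral
    over [l] of its integrals against [l] ([disintegration_integral]). Two
    instances carry the theorem. For [h = `|f| `^ p], a function of L^p(mu) is
    in L^p(l) for [nu]-almost all [l], and its norm in L^p(mu) is the norm of
    the section [l |-> [f]_l] ([fiber_section_normX]). For indicators, a
    property holds [mu]-almost everywhere exactly when it holds [l]-almost
    everywhere for [nu]-almost all [l] ([ae_disintegrationP]). Hence
    [f |-> [l |-> [f]_l]] induces a linear isometry S that preserves and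
    reflects the order. That [l |-> [f]_l] is a measurable section follows by
    approximating [f] by simple functions that it dominates: these converge to
    [f] in every fiber that contains [f].

    S is onto because of the second property: [beta = l] holds [l]-almost
    everywhere. A simple section, the sum of the [\1_A l *: x], is therefore
    the section of the single function that is the sum of the
    [\1_A (beta t) * x t] ([simple_section_fiber]). Simple sections are dense
    in the direct integral ([simple_section_dense]), and the range of an
    isometry defined on a complete space is closed
    ([isometric_dense_surjective]). So the direct integral is isometrically
    order isomorphic to the Banach lattice L^p(mu), and its own completeness
    and lattice structure need no separate argument
    ([isometric_banach_lattice]). The facts about a single L^p space that
    remain are the Riesz-Fischer theorem ([Lp_banach]), the description of
    suprema by pointwise maxima ([Lp_class_sup]), and the density of simple
    functions ([sfun_class_dense]).

    Both sides of the intertwining relation send the class of [f] to the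
    section of the translate of [f]; the representation property of the
    direct integral of the canonical representations is transported through S.

    For order indecomposability of L^p(l), let [1 = y + z] be the decomposition
    of the constant function along an invariant projection band. Disjointness
    makes [y] an indicator [1_Y]. The translates of [y] are in the band, so
    they are disjoint from [z], which says that [Y] is essentially invariant.
    By ergodicity [y] is 0 or 1, and no nonzero element is disjoint from 1
    ([ergodic_order_indecomposable]).

    Finally, [nu] does not depend on [beta]: as [l (beta @^-1` A)] is 1 if
    [A l] and 0 otherwise, disintegrating the set [beta @^-1` A] along another
    decomposition map [beta'] gives [mu (beta' @^-1` A)]
    ([decomposition_map_distribution]). *)

(** * Ordered vector spaces, complete spaces and isometries *)

Section ordered_vector_spaces.
Context (R : realType).

Lemma is_sup_unique (E : orderedVectorType R) (A : set E) x y :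
  is_sup A x -> is_sup A y -> x = y.
Proof.
by move=> [xu xl] [yu yl]; apply: vle_anti; [exact: xl|exact: yl].
Qed.

Lemma is_sup2P (E : orderedVectorType R) (x y z : E) :
  is_sup [set x; y] z <->
  [/\ x ≼ z, y ≼ z & forall w, x ≼ w -> y ≼ w -> z ≼ w].
Proof.
split=> [[zu zl]|[xz yz zl]].
  split; [by apply: zu; left|by apply: zu; right|].
  by move=> w xw yw; apply: zl => _ [->|->].
split=> [_ [->|->]//|w wu]; apply: zl; apply: wu; by [left|right].
Qed.

Lemma is_inf2P (E : orderedVectorType R) (x y z : E) :
  is_inf [set x; y] z <->
  [/\ z ≼ x, z ≼ y & forall w, w ≼ x -> w ≼ y -> w ≼ z].
Proof.
split=> [[zu zl]|[xz yz zl]].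
  split; [by apply: zu; left|by apply: zu; right|].
  by move=> w xw yw; apply: zl => _ [->|->].
split=> [_ [->|->]//|w wu]; apply: zl; apply: wu; by [left|right].
Qed.

Lemma linear_additive (E F : lmodType R) (f : E -> F) : linear f ->
  [/\ forall x y, f (x + y) = f x + f y, forall x y, f (x - y) = f x - f y,
      forall a x, f (a *: x) = a *: f x, f 0 = 0 & forall x, f (- x) = - f x].
Proof.
move=> lf.
have D x y : f (x + y) = f x + f y by rewrite -[x]scale1r lf !scale1r.
have f0 : f 0 = 0 by apply: (addrI (f 0)); rewrite -D !addr0.
have Z a x : f (a *: x) = a *: f x by rewrite -[a *: x]addr0 lf f0 addr0.
have N x : f (- x) = - f x by rewrite -scaleN1r Z scaleN1r.
by split=> // x y; rewrite D N.
Qed.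

Lemma norm_lattice_seminorm (E : orderedNormedType R) :
  (forall x y ax ay : E, is_modulus x ax -> is_modulus y ay -> ax ≼ ay ->
    `|x| <= `|y|) ->
  lattice_seminorm (fun x : E => `|x|).
Proof.
by move=> H; split=> //; split=> [x y|a x]; [exact: ler_normD|exact: normrZ].
Qed.

(** A Cauchy filter is reduced to a sequence: centers of balls of radius
    [q ^+ n / 2] in the filter satisfy the geometric bound since any two of
    these balls meet, and a limit of the centers is a limit of the filter. *)
Lemma banach_of_geometric (E : normedModType R) (q : R) : 0 < q -> q < 1 ->
  (forall u : nat -> E, (forall m n, (n <= m)%N -> `|u m - u n| <= q ^+ n) ->
     exists l : E, u @ \oo --> l) ->
  banach E.
Proof.
move=> q0 q1 H F FF /cauchyP cF.
pose r (n : nat) : R := 2^-1 * q ^+ n.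
have r0 n : 0 < r n by rewrite mulr_gt0// exprn_gt0.
have /choice[u Fu] n : exists x : E, F (ball x (r n)) by exact: cF.
have [m n nm|l ul] := H u.
  have [z [zm zn]] := filter_ex (filterI (Fu m) (Fu n)).
  move: zm zn; rewrite -!ball_normE /ball_/= => zm zn.
  rewrite -[u m](subrK z) -addrA (le_trans (ler_normD _ _))//.
  rewrite [leRHS](_ : _ = r n + r n); last first.
    by rewrite /r; lra.
  rewrite lerD//; last by rewrite distrC ltW.
  by rewrite (le_trans (ltW zm))// /r ler_wpM2l// ler_wiXn2l// ltW.
apply/cvg_ex; exists l; apply/cvgrPdist_lt => e e0.
have rl : r n @[n --> \oo] --> (0 : R).
  by apply: cvg_geometric; rewrite ger0_norm ?ltW.
near \oo => n.
have ln : `|l - u n| < e / 2.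
  by near: n; move/cvgrPdist_lt: ul; apply; rewrite divr_gt0.
have rn : r n < e / 2.
  near: n; move/cvgrPdist_lt: rl => /(_ (e / 2)).
  rewrite divr_gt0// => /(_ isT); apply: filterS => n.
  by rewrite sub0r normrN ger0_norm// ltW.
apply: filterS (Fu n) => x; rewrite -ball_normE /ball_/= => ux.
rewrite (splitr e) -[l](subrK (u n)) -addrA (le_lt_trans (ler_normD _ _))//.
by rewrite ltrD// (lt_trans ux).
Unshelve. all: by end_near. Qed.

Lemma banach_geometric_cvg (E : normedModType R) (v : nat -> E) : banach E ->
  (forall m n, (n <= m)%N -> `|v m - v n| <= 2^-1 ^+ n) ->
  exists x : E, v @ \oo --> x.
Proof.
move=> bE vC; suff : cvg (v @ \oo) by move=> /cvg_ex.
apply: bE; apply/cauchy_ballP => e e0.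
have [N Ne] : exists N, 2^-1 ^+ N < e / 2 :> R.
  have /cvgrPdist_lt/(_ (e / 2)) : geometric 1 (2^-1 : R) n @[n --> \oo] --> (0 : R).
    by apply: cvg_geometric; rewrite ger0_norm; lra.
  rewrite divr_gt0// => /(_ isT)[N _ /(_ N (leqnn N))] /=.
  by rewrite sub0r normrN mul1r ger0_norm//; exists N.
exists (v @` [set n | (N <= n)%N], v @` [set n | (N <= n)%N]) => /=.
  by split; exists N => // n Nn; exists n.
move=> [_ _] /= [[m Nm <-] [n Nn <-]]; rewrite -ball_normE /ball_/=.
rewrite -[v m](subrK (v N)) -addrA (le_lt_trans (ler_normD _ _))//.
rewrite (splitr e) ltrD//; first by rewrite (le_lt_trans (vC _ _ Nm)).
by rewrite distrC (le_lt_trans (vC _ _ Nn)).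
Qed.

(** The range is dense by assumption and closed because the domain is complete:
    preimages of a sequence that converges to [y] form a Cauchy sequence. *)
Lemma isometric_dense_surjective (E F : normedModType R) (f : E -> F) :
  linear f -> (forall x, `|f x| = `|x|) -> banach E ->
  (forall y e, 0 < e -> exists x, `|f x - y| < e) ->
  forall y, exists x, f x = y.
Proof.
move=> lf nf bE df y; have [_ B _ _ _] := linear_additive lf.
pose r n : R := 2^-1 * 2^-1 ^+ n.
have r0 n : 0 < r n by rewrite mulr_gt0// exprn_gt0.
have /choice[v vy] n := df y (r n) (r0 n).
have [m n nm|x vx] := @banach_geometric_cvg _ v bE.
  rewrite -nf B -[f (v m)](subrK y) -addrA (le_trans (ler_normD _ _))//.
  rewrite [leRHS](_ : _ = r n + r n); last by rewrite /r; lra.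
  rewrite lerD//; last by rewrite distrC ltW.
  rewrite (le_trans (ltW (vy m)))// /r ler_wpM2l// ler_wiXn2l//; lra.
exists x; apply: (@cvg_unique _ _ ((fun n => f (v n)) @ \oo)) => //.
  apply/cvgrPdist_lt => e e0; move/cvgrPdist_lt: vx => /(_ e e0).
  by apply: filterS => n; rewrite -B nf.
have rl : r n @[n --> \oo] --> (0 : R).
  by apply: cvg_geometric; rewrite ger0_norm; lra.
apply/cvgrPdist_lt => e e0; move/cvgrPdist_lt: rl => /(_ e e0).
apply: filterS => n; rewrite sub0r normrN ger0_norm ?ltW// distrC.
exact: lt_trans.
Qed.

Lemma isometric_banach (E F : normedModType R) (f : E -> F) :
  linear f -> (forall x, `|f x| = `|x|) -> (forall y, exists x, f x = y) ->
  banach E -> banach F.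
Proof.
move=> lf nf sf bE; have [_ B _ _ _] := linear_additive lf.
apply: (@banach_of_geometric _ 2^-1) => [||u uC]; [lra|lra|].
have /choice[v vu] n := sf (u n).
have vC m n : (n <= m)%N -> `|v m - v n| <= 2^-1 ^+ n.
  by move=> nm; rewrite -nf B !vu; exact: uC.
suff [x vx] : exists x : E, v @ \oo --> x.
  exists (f x); apply/cvgrPdist_lt => e e0; move/cvgrPdist_lt: vx => /(_ e e0).
  by apply: filterS => n; rewrite -vu -B nf.
exact: banach_geometric_cvg.
Qed.

(** Only the order enters the definition of a supremum, so a surjection that
    preserves and reflects the order transports suprema in both directions. *)
Lemma order_iso_is_sup2 (E F : orderedVectorType R) (f : E -> F) x y z :
  (forall y, exists x, f x = y) -> (forall x y, x ≼ y <-> f x ≼ f y) ->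
  is_sup [set x; y] z <-> is_sup [set f x; f y] (f z).
Proof.
move=> sf ff; split=> /is_sup2P[xz yz zl]; apply/is_sup2P; split.
- exact/ff.
- exact/ff.
- by move=> w'; have [w <-] := sf w' => /ff xw /ff yw; apply/ff; exact: zl.
- exact/ff.
- exact/ff.
- by move=> w /ff xw /ff yw; apply/ff; exact: zl.
Qed.

Lemma order_iso_lattice_hom (E F : orderedVectorType R) (f : E -> F) :
  linear f -> (forall y, exists x, f x = y) ->
  (forall x y, x ≼ y <-> f x ≼ f y) -> lattice_hom f.
Proof.
by move=> lf sf ff; split=> // x y z; case: (order_iso_is_sup2 x y z sf ff).
Qed.

(** This is how the direct integral is recognized as a Banach lattice. *)
Lemma isometric_banach_lattice (E F : orderedNormedType R) (f : E -> F) :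
  linear f -> (forall x, `|f x| = `|x|) -> (forall y, exists x, f x = y) ->
  (forall x y, x ≼ y <-> f x ≼ f y) -> banach_lattice E -> banach_lattice F.
Proof.
move=> lf nf sf ff [vE [_ nE] bE]; have [_ _ _ _ N] := linear_additive lf.
have supE x y z := @order_iso_is_sup2 E F f x y z sf ff.
split; last exact: isometric_banach nf sf bE.
  move=> x' y'; have [x <-] := sf x'; have [y <-] := sf y'.
  by have [z /supE xyz] := vE x y; exists (f z).
apply: norm_lattice_seminorm => x' y' ax' ay'.
have [[x <-] [y <-]] := (sf x', sf y'); have [[ax <-] [ay <-]] := (sf ax', sf ay').
rewrite /is_modulus -!N => /supE xax /supE yay /ff axy; rewrite !nf.
exact: nE xax yay axy.
Qed.

Lemma lattice_hom_seminorm (V : orderedVectorType R) (B : orderedNormedType R)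
    (i : V -> B) (N : V -> R) :
  lattice_hom i -> lattice_seminorm (fun x : B => `|x|) ->
  (forall x, `|i x| = N x) -> lattice_seminorm N.
Proof.
move=> [li si] [_ nB] iN; have [D _ Z _ oppi] := linear_additive li.
split; first split=> [x y|a x].
- by rewrite -!iN D ler_normD.
- by rewrite -!iN Z normrZ.
- move=> x y ax ay xax yay axy; rewrite -!iN.
  apply: (nB _ _ (i ax) (i ay)); rewrite /is_modulus -?oppi; [exact: si|exact: si|].
  suff /si/is_sup2P[] : is_sup [set ax; ay] ay by [].
  by apply/is_sup2P; split=> //; exact: vle_refl.
Qed.

Lemma representation_transport (G : groupType) (E F : normedModType R)
    (f : E -> F) (rho : G -> E -> E) (rho' : G -> F -> F) :
  linear f -> (forall x, `|f x| = `|x|) -> (forall y, exists x, f x = y) ->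
  (forall g x, f (rho g x) = rho' g (f x)) -> representation rho ->
  representation rho'.
Proof.
move=> lf nf sf ff' [brho rho1 rhoM]; split=> [g||g h].
- have [lrho [M rhoM']] := brho g; split=> [a y z|].
    have [[x <-] [w <-]] := (sf y, sf z).
    by rewrite -lf -!ff' lrho lf.
  by exists M => y; have [x <-] := sf y; rewrite -ff' !nf.
- by apply/funext => y; have [x <-] := sf y; rewrite -ff' rho1.
- by apply/funext => y; have [x <-] := sf y; rewrite /= -!ff' rhoM.
Qed.

Lemma operator_norm_le1 (E : normedModType R) (f : E -> E) :
  (forall x, `|f x| = `|x|) -> operator_norm f <= 1.
Proof.
move=> nf; apply: ge_sup => [|_ [x x1 <-]]; last by rewrite nf.
by exists `|f 0|, 0 => //=; rewrite normr0.
Qed.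

End ordered_vector_spaces.

(** * The lattice structure of an L^p space *)

Lemma le_powR_le (R : realType) (p a b : R) : 0 < p -> 0 <= a -> 0 <= b ->
  a `^ p <= b `^ p -> a <= b.
Proof.
move=> p0 a0 b0; apply: contra_le => ba.
by apply: gt0_ltr_powR; rewrite ?nnegrE.
Qed.

Section Lp_real.
Context d (T : measurableType d) (R : realType).
Variables (mu : {measure set T -> \bar R}) (p : R) (p1 : 1 <= p).
Implicit Types f g : T -> R.

Local Notation cl f := (Lp_class mu p1 (EFin \o f)).

Let p0 : 0 < p. Proof. exact: lt_le_trans p1. Qed.

Lemma Lp_integrableP (f : T -> \bar R) : f \in Lp_integrable mu p <->
  measurable_fun setT f /\ (\int[mu]_x (`|f x| `^ p) < +oo)%E.
Proof.
rewrite inE -powR_Lnorm ?gt_eqF//; split=> -[mf fy]; split=> //.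
  exact: poweR_lty.
by move: fy; apply: lty_poweRy; rewrite gt_eqF.
Qed.

(** Norms are handled through their [p]-th powers, which are plain integrals;
    this makes disintegration and convergence theorems applicable. *)
Lemma Lp_class_normX (f : T -> \bar R) : f \in Lp_integrable mu p ->
  (\int[mu]_x (`|f x| `^ p) = (`|Lp_class mu p1 f| `^ p)%:E)%E.
Proof.
move=> fP; rewrite -powR_Lnorm ?gt_eqF// Lp_class_norm// -poweR_EFin fineK//.
by rewrite ge0_fin_numE ?Lnorm_ge0//; move: fP; rewrite inE => -[].
Qed.

Lemma mem_Lp_integrable f :
  (f \in Lfun mu p%:E) = (EFin \o f \in Lp_integrable mu p).
Proof.
apply/idP/idP; first exact: Lp_integrable_EFin.
by move=> /(Lp_integrable_fine p1).
Qed.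

Lemma Lfun_measurable f : f \in Lfun mu p%:E -> measurable_fun setT f.
Proof. by rewrite inE => /andP[]; rewrite inE. Qed.

Lemma Lp_class_repr (q : Lp mu p1) : Lp_class mu p1 (repr q) = q.
Proof.
rewrite -[RHS]reprK /Lp_class; congr \pi%qT; apply/val_inj.
by rewrite insubdK//; exact: valP.
Qed.

Lemma Lp_integrable_ae_eq (f g : T -> \bar R) : measurable_fun setT f ->
  g \in Lp_integrable mu p -> {ae mu, forall x, f x = g x} ->
  f \in Lp_integrable mu p.
Proof.
move=> mf gP fg; have [mg gy] := set_mem gP; apply/mem_set; split=> //.
by rewrite (Lnorm_ae_eq p mf mg)//; apply: filterS fg => x + _.
Qed.

(** A [p]-integrable function is almost everywhere finite, so algebraic
    computations can be made with real valued representatives. *)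
Lemma Lp_class_real (q : Lp mu p1) : exists2 f, f \in Lfun mu p%:E & q = cl f.
Proof.
have [f fP ->] := Lp_class_surj q.
exists (fine \o f); first exact: Lp_integrable_fine.
apply/Lp_class_eq => //; first by rewrite -mem_Lp_integrable Lp_integrable_fine.
by apply: filterS (Lp_integrable_fin p1 fP) => x fx _ /=; rewrite fineK.
Qed.

Lemma Lp_real_class_eq f g : f \in Lfun mu p%:E -> g \in Lfun mu p%:E ->
  cl f = cl g <-> {ae mu, forall x, f x = g x}.
Proof.
move=> fP gP; rewrite Lp_class_eq -?mem_Lp_integrable//.
by split; apply: filterS => x; [move=> /(_ Logic.I)[]|move=> /= ->].
Qed.

Lemma Lp_real_class_le f g : f \in Lfun mu p%:E -> g \in Lfun mu p%:E ->
  cl f ≼ cl g <-> {ae mu, forall x, f x <= g x}.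
Proof. by move=> fP gP; rewrite Lp_class_le -?mem_Lp_integrable. Qed.

Lemma LfunZ a f : f \in Lfun mu p%:E -> a \*: f \in Lfun mu p%:E.
Proof.
move=> fP; have /= := LfunP (a *: (Lfun_Sub (p1 : (1 <= p%:E)%E) fP)).
by [].
Qed.

Lemma LfunD f g : f \in Lfun mu p%:E -> g \in Lfun mu p%:E ->
  f \+ g \in Lfun mu p%:E.
Proof.
move=> fP gP; pose pE : (1 <= p%:E)%E := p1.
exact: (LfunP (Lfun_Sub pE fP + Lfun_Sub pE gP)).
Qed.

Lemma LfunN f : f \in Lfun mu p%:E -> \- f \in Lfun mu p%:E.
Proof.
move=> fP; pose pE : (1 <= p%:E)%E := p1; exact: (LfunP (- Lfun_Sub pE fP)).
Qed.

Lemma LfunB f g : f \in Lfun mu p%:E -> g \in Lfun mu p%:E ->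
  f \- g \in Lfun mu p%:E.
Proof. by move=> fP gP; exact: LfunD fP (LfunN gP). Qed.

Lemma Lp_classN f : f \in Lfun mu p%:E -> cl (\- f) = - cl f.
Proof.
move=> fP; rewrite -scaleN1r -Lp_classZ//; congr Lp_class; apply/funext => x /=.
by congr EFin; apply/esym; exact: mulN1r.
Qed.

Lemma Lp_classB f g : f \in Lfun mu p%:E -> g \in Lfun mu p%:E ->
  cl (f \- g) = cl f - cl g.
Proof.
move=> fP gP; rewrite -Lp_classN// -Lp_classD//; exact: LfunN.
Qed.

Lemma Lfun_dominated f g : measurable_fun setT f -> g \in Lfun mu p%:E ->
  (forall x, `|f x| <= `|g x|) -> f \in Lfun mu p%:E.
Proof.
move=> mf; rewrite !mem_Lp_integrable => /Lp_integrableP[/measurable_EFinP mg gy] fg.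
apply/Lp_integrableP; split; first exact/measurable_EFinP.
apply: le_lt_trans gy; apply: ge0_le_integral => //=.
- apply/measurable_EFinP/(measurableT_comp (measurable_powR p)).
  exact: measurableT_comp.
- apply/measurable_EFinP/(measurableT_comp (measurable_powR p)).
  exact: measurableT_comp.
- by move=> x _; rewrite lee_fin ge0_ler_powR ?nnegrE ?(ltW p0).
Qed.

Lemma Lfun_normr f : f \in Lfun mu p%:E -> (Num.norm \o f) \in Lfun mu p%:E.
Proof.
move=> fP; apply: (Lfun_dominated _ fP) => [|x /=]; last by rewrite normr_id.
exact/measurableT_comp/Lfun_measurable.
Qed.

Lemma Lfun_max f g : f \in Lfun mu p%:E -> g \in Lfun mu p%:E ->
  f \max g \in Lfun mu p%:E.
Proof.
move=> fP gP; apply: (@Lfun_dominated _ ((Num.norm \o f) \+ (Num.norm \o g))).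
- by apply: measurable_maxr; exact: Lfun_measurable.
- by apply: LfunD; exact: Lfun_normr.
- move=> x /=; rewrite (ger0_norm (addr_ge0 _ _))//.
  rewrite maxEle; case: ifP => _; first by rewrite lerDr.
  by rewrite lerDl.
Qed.

Lemma Lp_class_sup f g : f \in Lfun mu p%:E -> g \in Lfun mu p%:E ->
  is_sup [set cl f; cl g] (cl (f \max g)).
Proof.
move=> fP gP; have fgP := Lfun_max fP gP; apply/is_sup2P; split.
- by apply/Lp_real_class_le => //; apply: aeW => x /=; rewrite le_max lexx.
- by apply/Lp_real_class_le => //; apply: aeW => x /=; rewrite le_max lexx orbT.
- move=> w; have [h hP ->] := Lp_class_real w => /Lp_real_class_le fh.
  move=> /Lp_real_class_le gh; apply/Lp_real_class_le => //.
  by apply: filterS2 (fh fP hP) (gh gP hP) => x /=; rewrite ge_max => -> ->.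
Qed.

Lemma Lp_class_modulus f : f \in Lfun mu p%:E ->
  is_modulus (cl f) (cl (Num.norm \o f)).
Proof.
move=> fP; rewrite /is_modulus -Lp_classN//.
rewrite (_ : Num.norm \o f = f \max \- f); last first.
  by apply/funext => x /=; apply/esym; exact: maxrN.
by apply: Lp_class_sup => //; exact: LfunN.
Qed.

Lemma Lp_vector_lattice : vector_lattice (Lp mu p1).
Proof.
move=> x y; have [[f fP ->] [g gP ->]] := (Lp_class_real x, Lp_class_real y).
by exists (cl (f \max g)); exact: Lp_class_sup.
Qed.

Lemma Lp_class_norm_le f g : f \in Lfun mu p%:E -> g \in Lfun mu p%:E ->
  {ae mu, forall x, `|f x| <= `|g x|} -> `|cl f| <= `|cl g|.
Proof.
move=> fP gP fg; have := fP; have := gP.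
rewrite !mem_Lp_integrable => gP' fP'; apply: (le_powR_le p0) => //.
rewrite -lee_fin -!Lp_class_normX//; apply: ae_ge0_le_integral => //=.
- apply/measurable_EFinP/(measurableT_comp (measurable_powR p)).
  exact/measurableT_comp/Lfun_measurable.
- apply/measurable_EFinP/(measurableT_comp (measurable_powR p)).
  exact/measurableT_comp/Lfun_measurable.
- apply: filterS fg => x fgx _.
  by rewrite lee_fin ge0_ler_powR ?nnegrE ?(ltW p0).
Qed.

Lemma Lp_lattice_seminorm : lattice_seminorm (fun x : Lp mu p1 => `|x|).
Proof.
apply: norm_lattice_seminorm => x y ax ay.
have [[f fP ->] [g gP ->]] := (Lp_class_real x, Lp_class_real y).
move=> /(is_sup_unique (Lp_class_modulus fP)) <-.
move=> /(is_sup_unique (Lp_class_modulus gP)) <-.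
by move=> /Lp_real_class_le fg; apply: Lp_class_norm_le => //; apply: fg; exact: Lfun_normr.
Qed.

End Lp_real.

(** * Completeness of L^p *)

Lemma cvgn_geometric_increments (R : realType) (u : R^nat) K :
  (forall n, `|u n.+1 - u n| <= K * 2^-1 ^+ n) -> cvgn u.
Proof.
move=> uK; have uE : u = cst (u 0%N) \+ series (telescope u).
  by apply/funext => n; rewrite [LHS]eq_sum_telescope.
rewrite uE; apply: is_cvgD; first exact: is_cvg_cst.
apply: normed_cvg.
apply: (@series_le_cvg _ _ (geometric `|K| 2^-1)) => [n|n|n|].
- exact: normr_ge0.
- by rewrite /= mulr_ge0.
- by apply: le_trans (uK n) _; rewrite /= ler_wpM2r// ?ler_norm.
- by apply: is_cvg_geometric_series; rewrite ger0_norm; lra.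
Qed.

Lemma cvg_powR (R : realType) (u : R^nat) (a p : R) : 0 < p ->
  (forall n, 0 <= u n) -> u @ \oo --> a -> u n `^ p @[n --> \oo] --> a `^ p.
Proof.
move=> p0 u0 ua; have a0 : 0 <= a.
  by apply: (closed_cvg (fun x : R => 0 <= x) (@closed_ge R 0) _ _ ua); exact: nearW.
have [a_gt0|] := ltP 0 a; last first.
  move=> a_le0; have {a0 a_le0} a0 : a = 0 by apply/le_anti; rewrite a0 a_le0.
  rewrite a0 powR0 ?gt_eqF//; apply/cvgrPdist_lt => e e0.
  move/cvgrPdist_lt : ua => /(_ (e `^ p^-1)); rewrite powR_gt0// => /(_ isT).
  apply: filterS => n; rewrite a0 !sub0r !normrN !ger0_norm ?powR_ge0// => une.
  rewrite (_ : e = (e `^ p^-1) `^ p); first by apply: gt0_ltr_powR; rewrite ?nnegrE// powR_ge0.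
  by rewrite -powRrM mulVf ?gt_eqF// powRr1 ?ltW.
have cp : {for a, continuous (fun x : R => expR (p * ln x))}.
  apply: (@continuous_comp _ _ _ (fun x => p * ln x) expR); last exact: continuous_expR.
  by apply: cvgM; [exact: cvg_cst|exact: continuous_ln].
rewrite /powR (gt_eqF a_gt0).
have := cvg_comp _ _ ua cp; apply: cvg_trans; apply: near_eq_cvg.
near=> n => /=; rewrite gt_eqF//.
by near: n; exact: (cvgr_gt _ ua).
Unshelve. all: by end_near. Qed.

Section Riesz_Fischer.
Context d (T : measurableType d) (R : realType).
Variables (mu : {measure set T -> \bar R}) (p : R) (p1 : 1 <= p).
Implicit Types f g : T -> R.

Local Notation cl f := (Lp_class mu p1 (EFin \o f)).

Let p0 : 0 < p. Proof. exact: lt_le_trans p1. Qed.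

Lemma Lp_class_normXE f : f \in Lfun mu p%:E ->
  (\int[mu]_x (`|f x| `^ p)%:E = (`|cl f| `^ p)%:E)%E.
Proof. by rewrite (mem_Lp_integrable mu p1) => /(Lp_class_normX p1) <-. Qed.

Let measurable_normX f : measurable_fun setT f ->
  measurable_fun setT (fun x => (`|f x| `^ p)%:E).
Proof.
move=> mf; apply/measurable_EFinP/(measurableT_comp (measurable_powR p)).
exact: measurableT_comp.
Qed.

(** The increments are multiplied by [2 ^+ n] before they are summed. Their
    norms are still summable, so the sum [H] of the [p]-th powers is integrable
    and thus finite almost everywhere. Where [H x] is finite it bounds every
    term, hence [`|f n.+1 x - f n x|] is at most [H x `^ p^-1 / 2 ^+ n], and the
    sequence converges. This bypasses the triangle inequality for infinite
    sums. *)
Lemma geometric_cauchy_ae_cvg (f : nat -> T -> R) :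
  (forall n, f n \in Lfun mu p%:E) ->
  (forall n, `|cl (f n.+1) - cl (f n)| <= 4^-1 ^+ n) ->
  {ae mu, forall x, cvgn (f ^~ x)}.
Proof.
move=> fP fC; pose g n : T -> R := (2 ^+ n) \*: (f n.+1 \- f n).
have gP n : g n \in Lfun mu p%:E.
  exact/LfunZ/LfunB.
have gN n : `|cl (g n)| <= 2^-1 ^+ n.
  rewrite Lp_classZ; last exact: LfunB.
  rewrite Lp_classB// normrZ ger0_norm// (le_trans (ler_wpM2l _ (fC n)))//.
  by rewrite -exprMn (_ : 2 * 4^-1 = 2^-1)//; lra.
have gX n : (\int[mu]_x (`|g n x| `^ p)%:E <= (2^-1 ^+ n)%:E)%E.
  rewrite Lp_class_normXE// lee_fin.
  apply: le_trans (ge0_ler_powR (ltW p0) _ _ (gN n)) _; rewrite ?nnegrE//.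
  by apply: ge1r_powR => //; rewrite exprn_gt0//= exprn_ile1//; lra.
pose H x := (\sum_(n <oo) (`|g n x| `^ p)%:E)%E.
have H0 x : (0 <= H x)%E by apply: nneseries_ge0 => n _ _; rewrite lee_fin powR_ge0.
have mg n : measurable_fun setT (fun x => (`|g n x| `^ p)%:E).
  exact/measurable_normX/(Lfun_measurable (gP n)).
have Hi : mu.-integrable setT H.
  apply/integrableP; split.
    by apply: ge0_emeasurable_sum => // n x _ _; rewrite lee_fin powR_ge0.
  under eq_integral do rewrite gee0_abs//.
  rewrite integral_nneseries//.
  apply: le_lt_trans (lee_nneseries _ (fun n _ => gX n)) _.
    by move=> n _ _; apply: integral_ge0 => x _; rewrite lee_fin powR_ge0.
  apply: (@le_lt_trans _ _ 2%:E); last exact: ltry.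
  apply: lime_le; first by apply: is_cvg_nneseries => n _ _; rewrite lee_fin exprn_ge0.
  apply: nearW => n; rewrite sumEFin lee_fin.
  suff -> : \sum_(0 <= i < n) 2^-1 ^+ i = 2 - 2 * 2^-1 ^+ n :> R.
    by have : 0 <= 2^-1 ^+ n :> R; [exact: exprn_ge0|lra].
  elim: n => [|n IHn]; first by rewrite big_geq// expr0; lra.
  by rewrite big_nat_recr//= IHn exprS; lra.
apply: filterS (integrable_ae measurableT Hi) => x /(_ Logic.I) Hx.
apply: (@cvgn_geometric_increments _ _ (fine (H x) `^ p^-1)) => n.
have : `|g n x| <= fine (H x) `^ p^-1.
  apply: (le_powR_le p0) => //; rewrite ?powR_ge0// -powRrM mulVf ?gt_eqF//.
  rewrite powRr1 ?fine_ge0// -lee_fin fineK//.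
  apply: le_trans (nneseries_lim_ge n.+1 _); last first.
    by move=> k _ _; rewrite lee_fin powR_ge0.
  rewrite sumEFin big_nat_recr//= lee_fin lerDr sumr_ge0//.
have -> : g n x = 2 ^+ n * (f n.+1 x - f n x) by [].
rewrite normrM ger0_norm ?exprn_ge0// => gx.
by rewrite exprVn ler_pdivlMr ?exprn_gt0// mulrC.
Qed.

(** Closed balls of L^p are closed under almost everywhere convergence: this is
    the lemma of Fatou for [p]-th powers. *)
Lemma Lp_class_norm_fatou (f : nat -> T -> R) g (C : R) :
  (forall n, f n \in Lfun mu p%:E) -> measurable_fun setT g -> 0 <= C ->
  (\forall n \near \oo, `|cl (f n)| <= C) ->
  {ae mu, forall x, f ^~ x @ \oo --> g x} ->
  g \in Lfun mu p%:E /\ `|cl g| <= C.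
Proof.
move=> fP mg C0 fC fg.
pose h n x := (`|f n x| `^ p)%:E.
have mh n : measurable_fun setT (h n) by exact/measurable_normX/Lfun_measurable.
have h0 n x : (0 <= h n x)%E by rewrite lee_fin powR_ge0.
have gC : (\int[mu]_x (`|g x| `^ p)%:E <= (C `^ p)%:E)%E.
  have -> : (\int[mu]_x (`|g x| `^ p)%:E = \int[mu]_x limn_einf (h ^~ x))%E.
    apply: ge0_ae_eq_integral => //.
    - exact: measurable_normX.
    - rewrite (_ : (fun x => _) = fun x => (- limn_esup (-%E \o (h ^~ x)))%E).
        apply: measurableT_comp => //.
        by apply: measurable_fun_limn_esup => n; exact: measurableT_comp.
      by apply/funext => x; rewrite limn_esupN oppeK.
    - move=> x _; rewrite limn_einf_lim; apply: lime_ge; first exact: is_cvg_einfs.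
      by apply: nearW => n; apply: le_ereal_inf_tmp => _ [m _ <-].
    - apply: filterS fg => x fgx _.
      have hx : h ^~ x @ \oo --> (`|g x| `^ p)%:E.
        apply/cvg_EFin; first exact: nearW.
        by apply: cvg_powR => //; exact: cvg_norm.
      rewrite is_cvg_limn_einfE; last by apply/cvg_ex; eexists; exact: hx.
      exact/esym/cvg_lim.
  apply: le_trans (fatou mu measurableT mh (fun n x _ => h0 n x)) _.
  rewrite limn_einf_lim; apply: lime_le; first exact: is_cvg_einfs.
  near=> n; apply: (@le_trans _ _ (\int[mu]_x h n x)%E).
    by apply: ereal_inf_lbound; exists n => /=.
  rewrite Lp_class_normXE// lee_fin ge0_ler_powR ?nnegrE ?(ltW p0)//.
  by near: n.
have gP : g \in Lfun mu p%:E.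
  rewrite (mem_Lp_integrable mu p1); apply/(Lp_integrableP mu p1); split.
    exact/measurable_EFinP.
  exact: le_lt_trans gC (ltry _).
split=> //; apply: (le_powR_le p0) => //.
by rewrite -lee_fin -Lp_class_normXE.
Unshelve. all: by end_near. Qed.

(** The almost everywhere limit [g] of the representatives [f n] is the limit in
    norm, because for fixed [n] the functions [f m \- f n] tend to [g \- f n] and
    have norm at most [4^-1 ^+ n]. *)
Lemma Lp_banach : banach (Lp mu p1).
Proof.
apply: (@banach_of_geometric _ _ 4^-1) => [||u uC]; [lra|lra|].
have /choice[f /all_and2[fP uf]] n : exists f, f \in Lfun mu p%:E /\ u n = cl f.
  by have [f fP ->] := Lp_class_real (u n); exists f.
have fcvg : {ae mu, forall x, cvgn (f ^~ x)}.
  by apply: geometric_cauchy_ae_cvg => // n; rewrite -!uf uC.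
(* The upper limit is a measurable function defined everywhere. *)
pose g x := fine (limn_esup (fun n => (f n x)%:E)).
have mg : measurable_fun setT g.
  apply: measurableT_comp => //; apply: measurable_fun_limn_esup => n.
  exact/measurable_EFinP/Lfun_measurable.
have fg : {ae mu, forall x, f ^~ x @ \oo --> g x}.
  apply: filterS fcvg => x /cvg_ex[l fl].
  have fl' : (f n x)%:E @[n --> \oo] --> l%:E by apply/cvg_EFin => //; exact: nearW.
  rewrite /g is_cvg_limn_esupE; last by apply/cvg_ex; exists l%:E.
  by rewrite (cvg_lim _ fl').
have gB n : (g \- f n) \in Lfun mu p%:E /\ `|cl (g \- f n)| <= 4^-1 ^+ n.
  apply: (@Lp_class_norm_fatou (fun m => f m \- f n)).
  - by move=> m; exact: LfunB.
  - by apply: measurable_funB => //; exact/Lfun_measurable.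
  - by rewrite exprn_ge0.
  - by near=> m; rewrite Lp_classB// -!uf; apply: uC; near: m; exact: nbhs_infty_ge.
  - by apply: filterS fg => x fgx; apply: cvgB => //; exact: cvg_cst.
have gP : g \in Lfun mu p%:E.
  rewrite (_ : g = (g \- f 0%N) \+ f 0%N); last first.
    by apply/funext => x /=; rewrite subrK.
  by apply: LfunD => //; case: (gB 0%N).
exists (cl g); apply/cvgrPdist_le => e e0.
have /cvgrPdist_lt/(_ _ e0) : geometric 1 (4^-1 : R) n @[n --> \oo] --> (0 : R).
  by apply: cvg_geometric; rewrite ger0_norm; lra.
apply: filterS => n; rewrite sub0r normrN /= mul1r ger0_norm ?exprn_ge0// => ne.
rewrite uf -Lp_classB//; case: (gB n) => _ /le_trans; apply; exact: ltW.
Unshelve. all: by end_near. Qed.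

End Riesz_Fischer.

(** * Simple functions in L^p *)

Section max_sfun.

Import HBSimple.

Context d (T : measurableType d) (R : realType).

Lemma sfun_vleP (f g : {sfun T >-> R}) : f ≼ g <-> forall x, f x <= g x.
Proof. exact: iff_refl. Qed.

Variables f g : {sfun T >-> R}.

HB.instance Definition _ := MeasurableFun.on (f \max g).

Definition max_sfun : {sfun T >-> R} := f \max g.

Lemma max_sfun_sup : is_sup [set f; g] max_sfun.
Proof.
have E x : max_sfun x = Num.max (f x) (g x) by [].
apply/is_sup2P; split.
- by apply/sfun_vleP => x; rewrite E le_max lexx.
- by apply/sfun_vleP => x; rewrite E le_max lexx orbT.
- move=> h /sfun_vleP fh /sfun_vleP gh; apply/sfun_vleP => x.
  by rewrite E ge_max fh gh.
Qed.

End max_sfun.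

Lemma sfun_vector_lattice d (T : measurableType d) (R : realType) :
  vector_lattice {sfun T >-> R}.
Proof. by move=> f g; exists (max_sfun f g); exact: max_sfun_sup. Qed.

Section Lp_simple.

Import HBSimple HBNNSimple.

Context d (T : measurableType d) (R : realType).
Variables (mu : {measure set T -> \bar R}) (p : R) (p1 : 1 <= p).

Local Notation cl f := (Lp_class mu p1 (EFin \o f)).

Let p0 : 0 < p. Proof. exact: lt_le_trans p1. Qed.

(** Where [f] is finite, [`|u n - f| `^ p] tends to 0 and is at most
    [`|2 * f| `^ p], so dominated convergence applies. *)
Lemma Lp_dominated_cvg (f : T -> \bar R) (u : nat -> T -> R) :
  f \in Lp_integrable mu p -> (forall n, measurable_fun setT (u n)) ->
  (forall n x, (`|u n x|%:E <= `|f x|)%E) ->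
  (forall x, (u n x)%:E @[n --> \oo] --> f x) ->
  (forall n, u n \in Lfun mu p%:E) /\ cl (u n) @[n --> \oo] --> Lp_class mu p1 f.
Proof.
move=> fP mu_ uf ulim; have [mf fy] := (Lp_integrableP mu p1 f).1 fP.
have uP n : u n \in Lfun mu p%:E.
  rewrite (mem_Lp_integrable mu p1); apply/(Lp_integrableP mu p1).
  split; first exact/measurable_EFinP.
  apply: le_lt_trans fy; apply: ge0_le_integral => //=.
  - apply/measurable_EFinP/(measurableT_comp (measurable_powR p)).
    exact: measurableT_comp.
  - exact/(measurableT_comp (measurable_poweR p))/measurableT_comp.
  - move=> x _; rewrite -poweR_EFin gt0_ler_poweR ?(ltW p0)// in_itv/= ?leey ?lee_fin ?normr_ge0//.
    by rewrite andbT abse_ge0.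
split=> //; have ffin := Lp_integrable_fin p1 fP.
pose g := fine \o f; have gP : g \in Lfun mu p%:E by exact: Lp_integrable_fine.
have -> : Lp_class mu p1 f = cl g.
  apply/Lp_class_eq => //; first by rewrite -(mem_Lp_integrable mu p1).
  by apply: filterS ffin => x fx _ /=; rewrite fineK.
have mg := Lfun_measurable gP.
have mX (h : T -> R) : measurable_fun setT h ->
    measurable_fun setT (fun x => (`|h x| `^ p)%:E).
  move=> mh; apply/measurable_EFinP/(measurableT_comp (measurable_powR p)).
  exact: measurableT_comp.
have ug : (\int[mu]_x (`|u n x - g x| `^ p)%:E)%E @[n --> \oo] --> 0%E.
  have := @dominated_convergence _ _ _ mu setT measurableT
    (fun n x => (`|u n x - g x| `^ p)%:E) (cst 0%E)
    (fun x => (`|2 * g x| `^ p)%:E).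
  case.
  - by move=> n; apply: mX; exact: measurable_funB.
  - exact: measurable_cst.
  - apply: filterS ffin => x fx _; apply/cvg_EFin; first exact: nearW.
    rewrite -[X in _ --> X](@powR0 _ p) ?gt_eqF//.
    apply: cvg_powR => //; rewrite -[X in _ --> X](@normr0 _ R).
    apply: cvg_norm; rewrite -[X in _ --> X](subrr (g x)).
    apply: cvgB; last exact: cvg_cst.
    have : (u n x)%:E @[n --> \oo] --> (g x)%:E by rewrite /g /= fineK.
    by move/fine_cvgP => [].
  - apply/integrableP; split; first by apply: mX; exact: measurable_funM.
    under eq_integral do rewrite gee0_abs ?lee_fin ?powR_ge0//.
    have := LfunZ p1 2 gP; rewrite (mem_Lp_integrable mu p1).
    by move=> /(Lp_integrableP mu p1)[].
  - apply: filterS ffin => x fx n _; rewrite gee0_abs ?lee_fin ?powR_ge0//.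
    rewrite ge0_ler_powR ?nnegrE ?(ltW p0)// normrM ger0_norm// mulr_natl mulr2n.
    have : `|u n x| <= `|g x|.
      by have := uf n x; rewrite -[f x]fineK// -abse_EFin lee_fin.
    by move=> ug; rewrite (le_trans (ler_normB _ _))// lerD2r.
  move=> _ _; rewrite integral0; apply: cvg_trans; apply: near_eq_cvg.
  by apply: nearW.
rewrite (_ : (fun n => _) = (fun n => (`|cl (u n) - cl g| `^ p)%:E)) in ug; last first.
  apply/funext => n; rewrite -Lp_classB// -Lp_class_normXE//; exact: LfunB.
move/fine_cvgP : ug => [_ /= ug].
have {}ug := cvg_powR (_ : 0 < p^-1) (fun n => powR_ge0 _ _) ug.
rewrite invr_gt0 powR0 ?invr_eq0 ?gt_eqF// in ug.
apply/cvgrPdist_lt => e e0; move/cvgrPdist_lt : (ug p0) => /(_ e e0).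
apply: filterS => n; rewrite sub0r normrN -powRrM divff ?gt_eqF// powRr1//.
by rewrite normr_id distrC.
Qed.

(** The positive and negative parts are approximated separately from below. Both
    approximants lie between 0 and [`|f|], and so does the absolute value of
    their difference. *)
Lemma sfun_approximation (f : T -> \bar R) : measurable_fun setT f ->
  exists u : nat -> {sfun T >-> R},
    (forall n x, (`|u n x|%:E <= `|f x|)%E) /\
    (forall x, (u n x)%:E @[n --> \oo] --> f x).
Proof.
move=> mf.
pose fp := nnsfun_approx measurableT (measurable_funepos mf).
pose fn := nnsfun_approx measurableT (measurable_funeneg mf).
exists (fun n => (fp n : {sfun T >-> R}) - (fn n : {sfun T >-> R})).
have fpE n x : ((fp n x)%:E <= f^\+%E x)%E.
  rewrite /fp nnsfun_approxE; exact: le_approx.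
have fnE n x : ((fn n x)%:E <= f^\-%E x)%E.
  rewrite /fn nnsfun_approxE; exact: le_approx.
split=> [n x|x].
  have -> : ((fp n : {sfun T >-> R}) - (fn n : {sfun T >-> R})) x = fp n x - fn n x by [].
  have p_ge0 : 0 <= fp n x by [].
  have n_ge0 : 0 <= fn n x by [].
  have fpa : ((fp n x)%:E <= `|f x|)%E.
    by apply: le_trans (fpE n x) _; rewrite funeposE ge_max abse_ge0 lee_abs.
  have fna : ((fn n x)%:E <= `|f x|)%E.
    by apply: le_trans (fnE n x) _; rewrite funenegE ge_max abse_ge0 -abseN lee_abs.
  have [h|h] := leP (fn n x) (fp n x).
    rewrite ger0_norm ?subr_ge0//; apply: le_trans fpa.
    by rewrite lee_fin gerBl.
  rewrite ltr0_norm ?subr_lt0// opprB; apply: le_trans fna.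
  by rewrite lee_fin gerBl.
rewrite (_ : (fun n => _) = (fun n => (fp n x)%:E - (fn n x)%:E)%E)//.
rewrite (funeposneg f); apply: cvgeB; first exact: add_def_funeposneg.
- exact: cvg_nnsfun_approx.
- exact: cvg_nnsfun_approx.
Qed.

Hypothesis mu_fin : (mu setT < +oo)%E.

Lemma sfun_Lfun (f : {sfun T >-> R}) : (f : T -> R) \in Lfun mu p%:E.
Proof.
have [M [_ /(_ (M + 1))]] := simple_bounded f; rewrite ltrDl ltr01 => /(_ isT) fM.
have cM : cst (M + 1) \in Lfun mu p%:E.
  rewrite (mem_Lp_integrable mu p1); apply/(Lp_integrableP mu p1); split.
    by apply/measurable_EFinP; exact: measurable_cst.
  under eq_integral do rewrite /= -poweR_EFin.
  rewrite integral_cst//= lte_mul_pinfty// ?poweR_ge0// poweR_EFin ltry.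
apply: (Lfun_dominated p1 _ cM) => //.
by move=> x; rewrite (le_trans (fM x Logic.I))// ler_norm.
Qed.

Lemma sfun_class_linear : linear (fun f : {sfun T >-> R} => cl f).
Proof.
move=> a f g; rewrite -Lp_classZ ?sfun_Lfun//.
by rewrite -Lp_classD ?sfun_Lfun//; exact/LfunZ/sfun_Lfun.
Qed.

Lemma sfun_class_lattice_hom : lattice_hom (fun f : {sfun T >-> R} => cl f).
Proof.
split; first exact: sfun_class_linear.
move=> f g h /(is_sup_unique (max_sfun_sup f g)) <-.
by apply: Lp_class_sup; exact: sfun_Lfun.
Qed.

Lemma sfun_class_norm (f : {sfun T >-> R}) :
  `|cl f| = fine 'N[mu]_(p%:E)[EFin \o f]%E.
Proof. by rewrite Lp_class_norm// -(mem_Lp_integrable mu p1) sfun_Lfun. Qed.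

Lemma sfun_class_dense : dense (range (fun f : {sfun T >-> R} => cl f)).
Proof.
move=> O [q Oq] oO; have [f fP qE] := Lp_class_surj q.
have [mf _] := (Lp_integrableP mu p1 f).1 fP.
have [u [uf uc]] := sfun_approximation mf.
have [//|_ ucl] := Lp_dominated_cvg fP _ uf uc.
have /ucl [N _ /(_ N (leqnn N)) ON] : nbhs (Lp_class mu p1 f) O.
  by rewrite -qE; exact: open_nbhs_nbhs.
by exists (cl (u N)); split => //; exists (u N).
Qed.

Lemma Lp_banach_lattice : banach_lattice (Lp mu p1).
Proof.
split; [exact: Lp_vector_lattice|exact: Lp_lattice_seminorm|exact: Lp_banach].
Qed.

Lemma sfun_seminorm_lattice : lattice_seminorm
  (fun f : {sfun T >-> R} => fine 'N[mu]_(p%:E)[EFin \o f]%E).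
Proof.
apply: (lattice_hom_seminorm sfun_class_lattice_hom (Lp_lattice_seminorm mu p1)).
exact: sfun_class_norm.
Qed.

End Lp_simple.

(** * Measurability of the evaluation of ergodic measures *)

Section borel_sets.
Context (R : realType).

Lemma borel_open (X : ptopologicalType) (U : set (borel X)) :
  open (U : set X) -> measurable U.
Proof. by move=> oU; exact: sub_sigma_algebra. Qed.

Lemma continuous_borel_real (X : ptopologicalType) (f : X -> R) :
  continuous f -> measurable_fun (setT : set (borel X)) (f : borel X -> R).
Proof.
move=> /continuousP cf; apply: (measurability _ (RGenOInfty.measurableE R)).
move=> _ [_ [x ->] <-]; rewrite setTI; apply: borel_open; apply: cf.
exact: interval_open.
Qed.

Lemma continuous_borel (X Y : ptopologicalType) (f : X -> Y) :
  continuous f -> measurable_fun (setT : set (borel X)) (f : borel X -> borel Y).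
Proof.
move=> /continuousP cf; apply: (@measurability _ _ _ (borel Y) _ _ open) => //.
by move=> _ [U oU <-]; rewrite setTI; apply: borel_open; exact: cf.
Qed.

(** The functions are [min (1, n * D)], where [D] is the distance to the
    complement of [U]. They link the topology on measures, which sees integrals
    of bounded continuous functions only, to the measures of open sets. *)
Lemma metrizable_open_indicator (X : topologicalType) (U : set X) :
  completely_metrizable R X -> open U ->
  exists h : nat -> X -> R,
    [/\ forall n, continuous (h n), forall n x, 0 <= h n x <= 1,
        forall x m n, (m <= n)%N -> h m x <= h n x &
        forall x, h n x @[n --> \oo] --> (\1_U x : R)].
Proof.
move=> [dist [[d0 dC dD] dN _]] oU.
have d_ge0 x y : 0 <= dist x y.
  have := dD y x x; rewrite (dC y x) (_ : dist x x = 0); last exact/d0.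
  by lra.
(* An infimum over the empty set is not a distance, so [U = X] is separate. *)
have [F0|/set0P[z0 Fz0]] := eqVneq (~` U) set0.
  exists (fun _ _ => 1); split=> [n x|n x|//|x]; first exact: cvg_cst.
    by rewrite ler01 lexx.
  rewrite (_ : U = setT); last by rewrite -[U]setCK F0 setC0.
  by rewrite indicT; exact: cvg_cst.
pose S x := [set dist x y | y in ~` U].
have Slb x : lbound (S x) 0 by move=> _ [y _ <-].
pose D x := inf (S x).
have D_ge0 x : 0 <= D x.
  by apply: lb_le_inf; [exists (dist x z0); exists z0|exact: Slb].
have Dle x y : ~ U y -> D x <= dist x y.
  by move=> Uy; apply: ge_inf; [exists 0; exact: Slb|exists y].
have Dlip x y : D x <= dist x y + D y.
  rewrite -lerBlDl; apply: lb_le_inf; first by exists (dist y z0); exists z0.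
  move=> _ [z Uz <-]; rewrite lerBlDl; exact: le_trans (Dle _ _ Uz) (dD _ _ _).
have Dc : continuous D.
  move=> x; apply/cvgrPdist_lt => e e0; apply/dN; exists e => // y /= xy.
  have := Dlip x y; have := Dlip y x; rewrite (dC y x) => yx xy'.
  by rewrite (le_lt_trans _ xy)// ler_norml; apply/andP; split; lra.
have DU x : U x -> 0 < D x.
  move=> Ux; have /dN[e e0 eU] : nbhs x U by exact: open_nbhs_nbhs.
  apply: (lt_le_trans e0); apply: lb_le_inf; first by exists (dist x z0); exists z0.
  by move=> _ [y Uy <-]; rewrite leNgt; apply/negP => /eU.
exists (fun n x => Num.min 1 (n%:R * D x)); split.
- move=> n x; apply: (@continuous_min _ _ (cst 1) (fun x => n%:R * D x)); first exact: cvg_cst.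
  by apply: cvgM; [exact: cvg_cst|exact: Dc].
- by move=> n x; rewrite le_min ler01 mulr_ge0//= ge_min lexx.
- move=> x m n mn; rewrite le_min ge_min lexx /= ge_min ler_wpM2r ?ler_nat ?orbT//.
- move=> x; rewrite indicE; have [/set_mem Ux|Ux] := boolP (x \in U).
    apply: cvg_near_cst; near=> n.
    apply/min_idPl; rewrite -ler_pdivrMr ?DU// mul1r.
    by near: n; exact: nbhs_infty_ger.
  rewrite (_ : (fun n => _) = cst 0); first exact: cvg_cst.
  apply/funext => n; rewrite (_ : D x = 0) ?mulr0 ?(min_idPr ler01)//.
  apply/le_anti; rewrite D_ge0 andbT -[leRHS](proj2 (d0 x x))//.
  by apply: Dle => Ux'; move: Ux; rewrite notin_setE.
Unshelve. all: by end_near. Qed.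

End borel_sets.

Section ergodic_decomposition.
Context (R : realType) (G : groupType) (X : ptopologicalType).
Variables (act : G -> X -> X) (e0 : ergodic_measure R act).

Local Notation E := (borel (ergodic_space e0)).

(** The preimage of an open set under such an integral is a member of the
    subbase that defines the topology. *)
Lemma continuous_ergodic_integral (h : X -> R) : continuous h ->
  (exists M, forall x, `|h x| <= M) ->
  continuous (fun l : ergodic_measure R act => \int[l]_x h x).
Proof.
move=> ch hM; apply/continuousP => U oU.
pose b (hU : (X -> R) * set R) := [set l : ergodic_measure R act | hU.2 (\int[l]_x hU.1 x)].
exists [set b (h, U)]; last by rewrite bigcup_set1.
move=> _ ->; exists (finmap.fset1 (h, U)).
  by move=> i /finmap.fset1P ->; apply/mem_set; split.
apply/seteqP; split=> [l /(_ (h, U))|l bl i /=].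
  by move=> bl; apply: bl; rewrite /= inE.
by move=> /finmap.fset1P ->.
Qed.

Lemma ergodic_measure_setT (l : E) : l setT = 1%E.
Proof. exact: probability_setT. Qed.

Hypothesis X_metrizable : completely_metrizable R X.

(** Dynkin's lemma: for open [Y] the evaluation is an increasing limit of
    continuous functions of [l], and the sets [Y] with measurable evaluation
    are stable under complements and disjoint countable unions. *)
Lemma measurable_ergodic_eval (Y : set (borel X)) : measurable Y ->
  measurable_fun setT (fun l : E => l Y).
Proof.
move=> mY.
apply: (@dynkin_induction _ (borel X) (@open X)
  [set Y | measurable_fun setT (fun l : E => l Y)]) => //.
- exact: openI.
- rewrite /=; under eq_fun do rewrite ergodic_measure_setT.
  exact: measurable_cst.
- move=> U oU /=; have [h [hc h01 hm hU]] := metrizable_open_indicator X_metrizable oU.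
  have mh n : measurable_fun setT (h n : borel X -> R) by exact: continuous_borel_real.
  have ih n (l : E) : l.-integrable setT (EFin \o (h n : borel X -> R)).
    apply: measurable_bounded_integrable => //.
      exact: le_lt_trans (probability_le1 l measurableT) (ltry _).
    exists 1; split=> // M M1 x _ /=; have /andP[h0 h1] := h01 n x.
    by rewrite ger0_norm// (le_trans h1)// ltW.
  apply: (@emeasurable_fun_cvg _ E R setT (fun n (l : E) => (\int[l]_x h n x)%:E)) => //.
    move=> n; apply/measurable_EFinP.
    apply: (@continuous_borel_real R (ergodic_space e0)).
    apply: continuous_ergodic_integral => //.
    by exists 1 => x; have /andP[h0 h1] := h01 n x; rewrite ger0_norm.
  move=> l _.
  have -> : (fun n => (\int[l]_x h n x)%:E) = (fun n => \int[l]_x (h n x)%:E)%E.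
    apply/funext => n; rewrite fineK//.
    by apply: integrable_fin_num; [exact: measurableT|exact: ih].
  have -> : l U = (\int[l]_x (\1_U x)%:E)%E.
    by rewrite integral_indic ?setIT//; exact: borel_open.
  rewrite [X in _ --> X](_ : _ = \int[l]_x limn (fun n => (h n x)%:E))%E; last first.
    apply: eq_integral => x _; apply/esym/cvg_lim => //.
    by apply/cvg_EFin; [exact: nearW|exact: hU].
  apply: cvg_monotone_convergence => //.
  + by move=> n; exact/measurable_EFinP.
  + by move=> n x _; rewrite lee_fin; have /andP[] := h01 n x.
  + by move=> x _ m n mn; rewrite lee_fin hm.
- move=> S mS PS /=.
  apply: (eq_measurable_fun (fun l : E => 1 - l S)%E).
    by move=> l _; rewrite probability_setC.
  by apply: emeasurable_funB => //; exact: measurable_cst.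
- move=> F mF tF PF /=.
  apply: (eq_measurable_fun (fun l : E => \sum_(0 <= k <oo) l (F k))%E).
    by move=> l _; rewrite measure_semi_bigcup//; exact: bigcup_measurable.
  apply: ge0_emeasurable_sum => [n l _ _|n _]; first exact: measure_ge0.
  exact: PF.
Qed.

End ergodic_decomposition.

(** * Disintegration of an invariant measure along the decomposition map *)

Section disintegration.
Context (R : realType) (G : groupType) (X : ptopologicalType).
Variables (act : G -> X -> X) (e0 : ergodic_measure R act).

Local Notation E := (borel (ergodic_space e0)).

Hypothesis X_metrizable : completely_metrizable R X.

Lemma measurable_ergodic_integral (h : borel X -> \bar R) :
  measurable_fun setT h -> (forall x, 0 <= h x)%E ->
  measurable_fun setT (fun l : E => \int[l]_x h x)%E.
Proof.
move=> mh h0.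
apply: (measurable_fun_integral_kernel (l := fun l : E => ergodic_prob l)) => //.
exact: measurable_ergodic_eval.
Qed.

Variables (mu : probability (borel X) R) (mu_invariant : invariant_measure act mu).
Variable beta : {mfun borel X >-> E}.
Hypothesis beta_decomposition : decomposition_map beta.

Local Notation nu := (distribution mu beta : probability E R).

(** An ergodic measure vanishes on nonmeasurable sets, whereas [l] takes the
    value 1 on this one. *)
Lemma measurable_decomposition_fiber (l : E) :
  measurable (beta @^-1` [set l] : set (borel X)).
Proof.
have [_ /(_ l) b1 _] := beta_decomposition.
apply: contrapT => /(ergodic_nonmeasurable l); rewrite b1 => /eqP.
by rewrite onee_eq0.
Qed.

Lemma decomposition_map_fiberC (l : E) : l (~` (beta @^-1` [set l])) = 0%E.
Proof.
have [_ /(_ l) b1 _] := beta_decomposition.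
by rewrite probability_setC ?b1 ?subee//; exact: measurable_decomposition_fiber.
Qed.

Lemma decomposition_map_fiber (l : E) : {ae l, forall x, beta x = l}.
Proof.
exists (~` (beta @^-1` [set l])); split=> //; last exact: decomposition_map_fiberC.
by apply: measurableC; exact: measurable_decomposition_fiber.
Qed.

Lemma decomposition_map_preimage (l : E) (A : set E) : measurable A ->
  l (beta @^-1` A) = (\1_A l)%:E.
Proof.
move=> mA; have mbA : measurable (beta @^-1` A : set (borel X)).
  by rewrite -[_ @^-1` _]setTI; exact: measurable_funP.
have [_ /(_ l) b1 _] := beta_decomposition.
have mF := measurable_decomposition_fiber l.
rewrite indicE; have [/set_mem lA|lA] := boolP (l \in A).
  apply/le_anti/andP; split; first exact: probability_le1.
  rewrite -[leLHS]b1; apply: le_measure.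
  - exact: mem_set.
  - exact: mem_set.
  - by move=> x /= ->.
apply/le_anti/andP; split; last exact: measure_ge0.
rewrite -[leRHS](decomposition_map_fiberC l); apply: le_measure.
- exact: mem_set.
- by apply: mem_set; exact: measurableC.
- by move=> x /= bA bx; move: lA; rewrite notin_setE -bx.
Qed.

Lemma disintegration_measure (Y : set (borel X)) : measurable Y ->
  mu Y = (\int[nu]_l l Y)%E.
Proof.
move=> mY; have [_ _ /(_ mu mu_invariant Y mY) ->] := beta_decomposition.
rewrite ge0_integral_pushforward//.
exact: measurable_ergodic_eval.
Qed.

(** The statement for sets says that [mu] agrees on Borel sets with the monadic
    bind of [nu] and the inclusion of the ergodic measures in all
    subprobabilities, and the integral against a bind is an iterated
    integral. *)
Lemma disintegration_integral (h : borel X -> \bar R) :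
  measurable_fun setT h -> (forall x, 0 <= h x)%E ->
  (\int[mu]_x h x = \int[nu]_l \int[l]_x h x)%E.
Proof.
move=> mh h0.
pose k (l : E) : giry (borel X) R := ergodic_prob l.
have mk : measurable_fun setT k.
  apply: measurable_giry_codensity => // B mB; exact: measurable_ergodic_eval.
rewrite -[RHS](giry_int_bind nu mk mh h0).
apply: eq_measure_integral => A mA _.
rewrite [LHS]disintegration_measure// -[RHS]/(giry_int (giry_map mk nu) (giry_ev ^~ A)).
rewrite giry_int_map//; exact: measurable_giry_ev.
Qed.

(** Apply the third property of [beta'] to the set [beta @^-1` A], which each
    ergodic measure [l] charges with 1 or 0 according to [A l]. *)
Lemma decomposition_map_distribution (beta' : {mfun borel X >-> E}) :
  decomposition_map beta' -> forall A : set E, measurable A ->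
  distribution mu beta' A = nu A.
Proof.
move=> [_ _ /(_ mu mu_invariant) dec'] A mA.
have mbA : measurable (beta @^-1` A : set (borel X)).
  by rewrite -[_ @^-1` _]setTI; exact: measurable_funP.
have mbA' : measurable (beta' @^-1` A : set (borel X)).
  by rewrite -[_ @^-1` _]setTI; exact: measurable_funP.
rewrite -[RHS]/(mu (beta @^-1` A)) -[LHS]/(mu (beta' @^-1` A)) (dec' _ mbA).
transitivity (\int[mu]_x (\1_(beta' @^-1` A) x)%:E)%E.
  by rewrite integral_indic// setIT.
apply: eq_integral => x _.
by rewrite decomposition_map_preimage.
Qed.

End disintegration.

(** * Simple sections of a direct integral *)

Section direct_integral_simple.
Context d (Omega : measurableType d) (R : realType) (V : orderedVectorType R).
Variables (F : banach_lattice_family Omega V).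
Variables (nu : {measure set Omega -> \bar R}) (p : R) (p1 : 1 <= p).
Implicit Types s t : section F.

Let p0 : 0 < p. Proof. exact: lt_le_trans p1. Qed.

Lemma family_class_linear (w : Omega) : linear (family_class F w : V -> F w).
Proof. by have [[_ /(_ w)[_ L _ _]]] := Defs.familyP F. Qed.

Lemma measurable_simple_section s : simple_section s -> measurable_section s.
Proof. by move=> ss; exists (fun=> s) => // w; exact: cvg_cst. Qed.

Lemma simple_section_restrict s (A : set Omega) : measurable A ->
  simple_section s -> simple_section ((fun w => \1_A w *: s w) : section F).
Proof.
move=> mA [l lm sE]; exists [seq (A `&` Bx.1, Bx.2) | Bx <- l].
  by move=> _ /mapP[Bx /lm mB ->]; exact: measurableI.
move=> w; rewrite sE big_map /=.
have [_ _ Z _ _] := linear_additive (family_class_linear w).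
rewrite -Z scaler_sumr; congr family_class; apply: eq_bigr => Bx _.
by rewrite scalerA indicI.
Qed.

Lemma measurable_section_normX s : measurable_section s ->
  measurable_fun setT (fun w => (`|s w| `^ p)%:E).
Proof.
move=> ms; apply/measurable_EFinP/(measurableT_comp (measurable_powR p)).
exact: measurable_section_norm.
Qed.

Lemma Lp_sectionP s : s \in Lp_section F nu p <->
  measurable_section s /\ (\int[nu]_w (`|s w| `^ p)%:E < +oo)%E.
Proof. by split=> [/set_mem|?]//; exact: mem_set. Qed.

Lemma Lp_sectionZ (a : R) s : s \in Lp_section F nu p ->
  a *: s \in Lp_section F nu p.
Proof.
have [S0 SL] := Lp_section_submod_closed F nu p1.
by move=> sP; have := SL a s 0 sP S0; rewrite addr0.
Qed.

Lemma Lp_sectionD s t : s \in Lp_section F nu p -> t \in Lp_section F nu p ->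
  s + t \in Lp_section F nu p.
Proof.
have [S0 SL] := Lp_section_submod_closed F nu p1.
by move=> sP tP; have := SL 1 s t sP tP; rewrite scale1r.
Qed.

Lemma Lp_sectionB s t : s \in Lp_section F nu p -> t \in Lp_section F nu p ->
  s - t \in Lp_section F nu p.
Proof.
have [S0 SL] := Lp_section_submod_closed F nu p1.
by move=> sP tP; have := SL (-1) t s tP sP; rewrite scaleN1r addrC.
Qed.

Lemma section_classB s t : s \in Lp_section F nu p -> t \in Lp_section F nu p ->
  section_class F nu p1 (s - t) = section_class F nu p1 s - section_class F nu p1 t.
Proof.
move=> sP tP; have NP := Lp_sectionZ (-1) tP.
have -> : s - t = s + -1 *: t by rewrite scaleN1r.
by rewrite (section_classD p1 sP NP) (section_classZ p1 (-1) tP) scaleN1r.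
Qed.

Lemma Lp_section_dominated s t : measurable_section s ->
  t \in Lp_section F nu p -> (forall w, `|s w| <= `|t w|) ->
  s \in Lp_section F nu p.
Proof.
move=> ms tP st; have [mt ty] := (Lp_sectionP t).1 tP.
apply/Lp_sectionP; split; first exact: ms.
apply: le_lt_trans ty; apply: ge0_le_integral => //.
- exact: measurable_section_normX.
- exact: measurable_section_normX.
- by move=> w _; rewrite lee_fin ge0_ler_powR ?nnegrE// ltW.
Qed.

Lemma section_class_normX s : s \in Lp_section F nu p ->
  (\int[nu]_w (`|s w| `^ p)%:E = (`|section_class F nu p1 s| `^ p)%:E)%E.
Proof.
move=> sP; have /Lp_sectionP[ms sy] := sP.
have s0 : (0 <= \int[nu]_w (`|s w| `^ p)%:E)%E.
  by apply: integral_ge0 => w _; rewrite lee_fin powR_ge0.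
rewrite section_class_norm// -poweR_EFin fineK; last first.
  by apply: fin_num_poweR; rewrite ge0_fin_numE.
by rewrite -poweRrM mulVf ?gt_eqF// poweRe1.
Qed.

(** Pointwise approximants [s_ k] of [s] need not be integrable. They are cut off
    to 0 where [`|s_ k w| > 2 * `|s w|], a measurable set. Where [s w] is nonzero
    the cut-off is eventually void, and where [s w = 0] it leaves 0. The
    cut-off approximants are dominated by [2 *: s], so dominated convergence
    gives convergence in norm. *)
Lemma simple_section_dense (s : section F) (e : R) :
  s \in Lp_section F nu p -> 0 < e ->
  exists t, [/\ simple_section t, t \in Lp_section F nu p &
    `|section_class F nu p1 t - section_class F nu p1 s| < e].
Proof.
move=> sP e0; have /Lp_sectionP[ms sy] := sP.
have [s_ ss sl] := ms.
pose A k := [set w | `|s_ k w| <= `|(2 *: s) w|].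
have mA k : measurable (A k).
  rewrite -[A k]setTI; apply: (measurable_fun_le measurableT).
    exact/measurable_section_norm/measurable_simple_section.
  by apply: measurable_section_norm; have /Lp_sectionP[] := Lp_sectionZ 2 sP.
pose t_ k : section F := fun w => \1_(A k) w *: s_ k w.
have ts k : simple_section (t_ k) by exact: simple_section_restrict.
have t_le k w : `|t_ k w| <= `|(2 *: s) w|.
  rewrite /t_ indicE; case: (boolP (w \in A k)) => [/set_mem Aw|_].
    by rewrite scale1r.
  by rewrite scale0r normr0.
have tP k : t_ k \in Lp_section F nu p.
  apply: Lp_section_dominated (Lp_sectionZ 2 sP) (t_le k).
  exact: measurable_simple_section.
have tl w : t_ k w @[k --> \oo] --> s w.
  have [sw0|sw0] := eqVneq (s w) 0.
    rewrite sw0 (_ : (fun k => _) = cst 0); first exact: cvg_cst.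
    apply/funext => k; apply/eqP; rewrite -normr_le0 (le_trans (t_le k w))//.
    by rewrite [(2 *: s) w](_ : _ = 2 *: s w)// sw0 scaler0 normr0.
  apply: cvg_trans (sl w); apply: near_eq_cvg; near=> k.
  rewrite /t_ indicE mem_set ?scale1r// /A /=.
  rewrite [(2 *: s) w](_ : _ = 2 *: s w)// normrZ ger0_norm//.
  apply: ltW; near: k; apply: (cvgr_lt `|s w|); first exact: (cvg_norm (sl w)).
  by rewrite ltr_pMl ?normr_gt0// ltr1n.
have : (\int[nu]_w (`|(t_ k - s) w| `^ p)%:E)%E @[k --> \oo] --> 0%E.
  have [] := @dominated_convergence _ _ _ nu setT measurableT
    (fun k w => (`|(t_ k - s) w| `^ p)%:E) (cst 0%E)
    (fun w => (`|(3 *: s) w| `^ p)%:E).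
  - move=> k; apply: measurable_section_normX.
    by have /Lp_sectionP[] := Lp_sectionB (tP k) sP.
  - exact: measurable_cst.
  - apply: aeW => w _; apply/cvg_EFin; first exact: nearW.
    rewrite -[X in _ --> X](@powR0 _ p) ?gt_eqF//.
    apply: cvg_powR => //; rewrite -[X in _ --> X](@normr0 _ (F w)).
    apply: cvg_norm; rewrite -[X in _ --> X](subrr (s w)).
    by apply: cvgB; [exact: tl|exact: cvg_cst].
  - have /Lp_sectionP[m3s i3s] := Lp_sectionZ 3 sP.
    apply/integrableP; split; first exact: measurable_section_normX.
    by under eq_integral do rewrite gee0_abs ?lee_fin ?powR_ge0//.
  - apply: aeW => w k _; rewrite gee0_abs ?lee_fin ?powR_ge0//.
    rewrite ge0_ler_powR ?nnegrE ?(ltW p0)//.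
    rewrite [(3 *: s) w](_ : _ = 3 *: s w)// [(_ - s) w](_ : _ = t_ k w - s w)//.
    rewrite (le_trans (ler_normB _ _))// (le_trans (lerD (t_le k w) (lexx _)))//.
    by rewrite [(2 *: s) w](_ : _ = 2 *: s w)// !normrZ !ger0_norm//; lra.
  by move=> _ _; rewrite integral0.
rewrite (_ : (fun k => _) = (fun k =>
  (`|section_class F nu p1 (t_ k) - section_class F nu p1 s| `^ p)%:E)); last first.
  apply/funext => k; rewrite (section_class_normX (Lp_sectionB (tP k) sP)).
  by rewrite (section_classB (tP k) sP).
move=> /fine_cvgP[_ /= /cvgrPdist_lt/(_ (e `^ p))].
rewrite powR_gt0// => /(_ isT) [N _ /(_ N (leqnn N))] /=.
rewrite sub0r normrN ger0_norm ?powR_ge0// => h.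
exists (t_ N); split; [exact: ts|exact: tP|].
rewrite ltNge; apply: contraTN h => h; rewrite -leNgt.
by apply: ge0_ler_powR; rewrite ?nnegrE ?(ltW p0)// ltW.
Unshelve. all: by end_near. Qed.

End direct_integral_simple.

(** * The family of the L^p spaces of the ergodic measures *)

Section ergodic_Lp_family.

Import HBSimple.

Context (R : realType) (G : groupType) (X : ptopologicalType).
Variables (act : G -> X -> X) (e0 : ergodic_measure R act).
Variables (p : R) (p1 : 1 <= p).

Local Notation E := (borel (ergodic_space e0)).

Hypothesis X_metrizable : completely_metrizable R X.

Lemma probability_setT_lty (l : probability (borel X) R) : (l setT < +oo)%E.
Proof. by rewrite probability_setT ltry. Qed.

Lemma measurable_integral_normX (f : borel X -> \bar R) : measurable_fun setT f ->
  measurable_fun setT (fun l : E => \int[l]_x (`|f x| `^ p))%E.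
Proof.
move=> mf; apply: measurable_ergodic_integral => //; last first.
  by move=> x; exact: poweR_ge0.
exact/(measurableT_comp (measurable_poweR p))/measurableT_comp.
Qed.

Lemma ergodic_Lp_family : measurable_banach_lattice_family (Omega := E)
  (V := {sfun borel X >-> R}) (B := fun l => Lp (ergodic_prob l) p1)
  (fun l => simple_seminorm p l) (fun l => simple_class p1 l).
Proof.
have lfin (l : E) := probability_setT_lty l.
split.
- split=> [|l].
    split=> [l|f].
      by have [] := sfun_seminorm_lattice p1 (lfin l).
    have mf : measurable_fun setT (EFin \o f).
      by apply/measurable_EFinP; exact: measurable_funP.
    rewrite /simple_seminorm unlock /=; apply: measurableT_comp => //.
    apply/(measurableT_comp (measurable_poweR p^-1)).
    exact: (measurable_integral_normX mf).
  split.
  + exact: Lp_banach.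
  + exact: (sfun_class_linear p1 (lfin l)).
  + exact: (sfun_class_norm p1 (lfin l)).
  + by apply: sfun_class_dense.
- exact: sfun_vector_lattice.
- by move=> l; exact: (sfun_seminorm_lattice p1 (lfin l)).
- by move=> l; exact: Lp_banach_lattice.
- by move=> l; exact: (sfun_class_lattice_hom p1 (lfin l)).
Qed.

End ergodic_Lp_family.

(** * The isometric lattice isomorphism S *)

Section disintegrated_sections.

Import HBSimple.

Context (R : realType) (G : groupType) (X : ptopologicalType).
Variables (act : G -> X -> X) (e0 : ergodic_measure R act).
Variables (p : R) (p1 : 1 <= p).

Local Notation E := (borel (ergodic_space e0)).

Hypothesis X_metrizable : completely_metrizable R X.
Variables (mu : probability (borel X) R) (mu_invariant : invariant_measure act mu).
Variable beta : {mfun borel X >-> E}.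
Hypothesis beta_decomposition : decomposition_map beta.
Variable H : measurable_banach_lattice_family (Omega := E)
  (V := {sfun borel X >-> R}) (B := fun l => Lp (ergodic_prob l) p1)
  (fun l => simple_seminorm p l) (fun l => simple_class p1 l).

Local Notation nu := (distribution mu beta : probability E R).
Local Notation F := (BanachLatticeFamily H).

Let p0 : 0 < p. Proof. exact: lt_le_trans p1. Qed.

(** The disintegrated section of [f], typed as a section of the family [F]. *)
Definition fiber_section (f : X -> \bar R) : section F :=
  fun l => disintegrated_section p1 f l.

Lemma measure0_disintegration (N : set (borel X)) : measurable N ->
  mu N = 0%E <-> {ae nu, forall l : E, l N = 0%E}.
Proof.
move=> mN; have mlN := @measurable_ergodic_eval _ _ _ _ e0 X_metrizable _ mN.
rewrite (disintegration_measure X_metrizable mu_invariant beta_decomposition mN).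
rewrite (_ : (\int[nu]_l l N = \int[nu]_l `|l N|)%E); last first.
  by apply: eq_integral => l _; rewrite gee0_abs.
rewrite (ae_eq_integral_abs nu measurableT mlN).
by split; apply: filterS => l; [move=> /(_ Logic.I)|move=> + _].
Qed.

Lemma ae_disintegration (P : X -> Prop) :
  {ae mu, forall x, P x} -> {ae nu, forall l : E, {ae l, forall x, P x}}.
Proof.
move=> [N [mN N0 PN]].
have /(measure0_disintegration mN) := N0.
by apply: filterS => l lN; exists N.
Qed.

(** For the converse, the null sets of the single fibers are caught by the
    complement of [P], which has to be measurable in order that its
    [mu]-measure is the integral of its [l]-measures. *)
Lemma ae_disintegrationP (P : X -> Prop) : measurable ([set x | P x] : set (borel X)) ->
  {ae mu, forall x, P x} <-> {ae nu, forall l : E, {ae l, forall x, P x}}.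
Proof.
move=> mP; split; first exact: ae_disintegration.
have mN : measurable (~` [set x | P x] : set (borel X)) by exact: measurableC.
move=> lP; apply/negligibleP => //; apply/measure0_disintegration => //.
by apply: filterS lP => l /negligibleP; exact.
Qed.

Lemma fiber_normX_ge0 (f : borel X -> \bar R) (l : E) :
  (0 <= \int[l]_x (`|f x| `^ p))%E.
Proof. by apply: integral_ge0 => x _; exact: poweR_ge0. Qed.

Lemma fiber_integral_normX (f : borel X -> \bar R) : measurable_fun setT f ->
  (\int[mu]_x (`|f x| `^ p) = \int[nu]_l \int[l]_x (`|f x| `^ p))%E.
Proof.
move=> mf; apply: disintegration_integral => //.
  exact/(measurableT_comp (measurable_poweR p))/measurableT_comp.
by move=> x; exact: poweR_ge0.
Qed.

Lemma ae_fiber_Lp_integrable (f : borel X -> \bar R) : f \in Lp_integrable mu p ->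
  {ae nu, forall l : E, f \in Lp_integrable l p}.
Proof.
move=> /(Lp_integrableP mu p1)[mf fy].
have mJ := @measurable_integral_normX _ _ _ _ e0 p X_metrizable _ mf.
have iJ : nu.-integrable setT (fun l : E => \int[l]_x (`|f x| `^ p))%E.
  apply/integrableP; split; first exact: mJ.
  under eq_integral do rewrite gee0_abs ?fiber_normX_ge0//.
  by rewrite -(fiber_integral_normX mf).
apply: filterS (integrable_ae measurableT iJ) => l /(_ Logic.I).
rewrite ge0_fin_numE ?fiber_normX_ge0// => ly.
by apply/(Lp_integrableP _ p1).
Qed.

(** Simple functions [u k] dominated by [f] converge to [f] in every fiber that
    contains [f]; the set [B] of these fibers is measurable, and multiplication
    by its indicator gives the value 0 in the other fibers. *)
Lemma measurable_fiber_section (f : borel X -> \bar R) : measurable_fun setT f ->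
  measurable_section (fiber_section f).
Proof.
move=> mf; have [u [uf ul]] := sfun_approximation mf.
pose B := [set l : E | (\int[l]_x (`|f x| `^ p) < +oo)%E].
have mB : measurable B.
  rewrite -[B]setTI.
  apply: emeasurable_fun_infty_o => //; exact: measurable_integral_normX.
pose s_ k : section F := fun l => family_class F l (\1_B l *: u k).
exists s_ => [k|l].
  exists [:: (B, u k)]; first by move=> Ax /[!inE] /eqP ->.
  by move=> l; rewrite big_seq1.
suff : simple_class p1 l (\1_B l *: u k) @[k --> \oo] -->
    disintegrated_section p1 f l by exact.
rewrite /disintegrated_section; case: ifPn => fP.
  have lB : B l by have [] := (Lp_integrableP l p1 f).1 fP.
  rewrite indicE mem_set//; under eq_fun do rewrite scale1r.
  have mu_ k : measurable_fun setT (u k : borel X -> R) by exact: measurable_funP.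
  have [_] := Lp_dominated_cvg p1 fP mu_ uf ul.
  exact.
have lB : ~ B l by move=> lB; move/negP: fP; apply; apply/(Lp_integrableP l p1).
rewrite indicE memNset//; under eq_fun do rewrite scale0r.
have [_ _ _ c0 _] := linear_additive (sfun_class_linear p1 (probability_setT_lty l)).
have {}c0 : simple_class p1 l 0 = 0 by exact: c0.
by rewrite c0; exact: cvg_cst.
Qed.

Lemma fiber_sectionE (f : borel X -> \bar R) (l : E) : f \in Lp_integrable l p ->
  fiber_section f l = Lp_class l p1 f.
Proof. by move=> fP; rewrite /fiber_section /disintegrated_section fP. Qed.

Lemma fiber_section_normX (f : borel X -> \bar R) : f \in Lp_integrable mu p ->
  (\int[nu]_l (`|fiber_section f l| `^ p)%:E = \int[mu]_x (`|f x| `^ p))%E.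
Proof.
move=> fP; have [mf fy] := (Lp_integrableP mu p1 f).1 fP.
rewrite fiber_integral_normX//; apply: ge0_ae_eq_integral => //.
- by apply: measurable_section_normX; exact: measurable_fiber_section.
- exact: measurable_integral_normX.
- by move=> l _; exact: fiber_normX_ge0.
- apply: filterS (ae_fiber_Lp_integrable fP) => l flP _.
  by rewrite fiber_sectionE// (Lp_class_normX p1 flP).
Qed.

Lemma fiber_section_Lp (f : borel X -> \bar R) : f \in Lp_integrable mu p ->
  fiber_section f \in Lp_section F nu p.
Proof.
move=> fP; have [mf fy] := (Lp_integrableP mu p1 f).1 fP.
apply/Lp_sectionP; split; first exact: measurable_fiber_section.
by rewrite fiber_section_normX.
Qed.

Lemma fiber_section_ae_eq (f g : borel X -> \bar R) :
  f \in Lp_integrable mu p -> g \in Lp_integrable mu p ->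
  f = g %[ae mu] -> {ae nu, forall l, fiber_section f l = fiber_section g l}.
Proof.
move=> fP gP /ae_disintegration fg.
apply: filterS3 (ae_fiber_Lp_integrable fP) (ae_fiber_Lp_integrable gP) fg.
move=> l flP glP fgl.
by rewrite !fiber_sectionE//; apply/(Lp_class_eq p1 flP glP).
Qed.

Definition disintegration_map (q : Lp mu p1) : Lp_direct_integral F nu p1 :=
  section_class F nu p1 (fiber_section (repr q)).

Lemma disintegration_mapE (f : borel X -> \bar R) : f \in Lp_integrable mu p ->
  disintegration_map (Lp_class mu p1 f) = section_class F nu p1 (fiber_section f).
Proof.
move=> fP; have rP : (repr (Lp_class mu p1 f) : borel X -> \bar R) \in Lp_integrable mu p.
  exact: valP.
apply/(section_class_eq p1 (fiber_section_Lp rP) (fiber_section_Lp fP)).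
apply: (fiber_section_ae_eq rP fP).
by apply/(Lp_class_eq p1 rP fP); exact: Lp_class_repr.
Qed.

Lemma disintegration_map_le (x y : Lp mu p1) :
  x ≼ y <-> disintegration_map x ≼ disintegration_map y.
Proof.
have [[f fP ->] [g gP ->]] := (Lp_class_surj x, Lp_class_surj y).
have [mf _] := (Lp_integrableP mu p1 f).1 fP.
have [mg _] := (Lp_integrableP mu p1 g).1 gP.
rewrite (disintegration_mapE fP) (disintegration_mapE gP).
rewrite (section_class_le p1 (fiber_section_Lp fP) (fiber_section_Lp gP)).
rewrite (Lp_class_le p1 fP gP) ae_disintegrationP; last first.
  by have := measurable_lee measurableT mf mg; rewrite setTI.
split; apply: filterS3 (ae_fiber_Lp_integrable fP) (ae_fiber_Lp_integrable gP) => l flP glP.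
  by move=> fgl; rewrite !fiber_sectionE//; apply/(Lp_class_le p1 flP glP).
by rewrite !fiber_sectionE// => /(Lp_class_le p1 flP glP).
Qed.

Lemma disintegration_map_linear : linear disintegration_map.
Proof.
move=> a x y.
have [[f fP ->] [g gP ->]] := (Lp_class_real x, Lp_class_real y).
have afP := LfunZ p1 a fP; have afgP := LfunD p1 afP gP.
have fI : EFin \o f \in Lp_integrable mu p by rewrite -(mem_Lp_integrable mu p1).
have gI : EFin \o g \in Lp_integrable mu p by rewrite -(mem_Lp_integrable mu p1).
have afgI : EFin \o (a \*: f \+ g) \in Lp_integrable mu p.
  by rewrite -(mem_Lp_integrable mu p1).
rewrite -(Lp_classZ p1 a fP) -(Lp_classD p1 afP gP).
rewrite (disintegration_mapE fI) (disintegration_mapE gI) (disintegration_mapE afgI).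
have fS := fiber_section_Lp fI; have gS := fiber_section_Lp gI.
have afS := Lp_sectionZ p1 a fS.
rewrite -(section_classZ p1 a fS) -(section_classD p1 afS gS).
have afgS := Lp_sectionD p1 afS gS.
apply/(section_class_eq p1 (fiber_section_Lp afgI) afgS).
apply: filterS3 (ae_fiber_Lp_integrable fI) (ae_fiber_Lp_integrable gI)
  (ae_fiber_Lp_integrable afgI) => l flI glI afglI.
have flP : f \in Lfun l p%:E by rewrite (mem_Lp_integrable l p1).
have glP : g \in Lfun l p%:E by rewrite (mem_Lp_integrable l p1).
rewrite fiber_sectionE// (Lp_classD p1 (LfunZ p1 a flP) glP) (Lp_classZ p1 a flP).
by rewrite -(fiber_sectionE flI) -(fiber_sectionE glI).
Qed.

Lemma disintegration_map_norm (x : Lp mu p1) : `|disintegration_map x| = `|x|.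
Proof.
have [f fP ->] := Lp_class_surj x; rewrite (disintegration_mapE fP).
apply: (powR_injective p0); rewrite ?nnegrE//; apply: EFin_inj.
rewrite -(section_class_normX p1 (fiber_section_Lp fP)) (fiber_section_normX fP).
exact: Lp_class_normX.
Qed.

(** A coefficient [\1_A l] of a simple section depends on the fiber only. As
    [beta x = l] for [l]-almost all [x], it can be moved into the function as
    [\1_A (beta x)]. *)
Lemma simple_section_fiber (t : section F) : simple_section t ->
  exists f : borel X -> R, measurable_fun setT f /\
    forall l : E, EFin \o f \in Lp_integrable l p /\ t l = Lp_class l p1 (EFin \o f).
Proof.
move=> [L Lm tE].
pose f x := \sum_(Ax <- L) \1_(Ax.1) (beta x) * (Ax.2 : {sfun borel X >-> R}) x.
have mf : measurable_fun setT (f : borel X -> R).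
  rewrite /f; elim: (L) Lm => [|Ax K IHK] Km.
    by under eq_fun do rewrite big_nil; exact: measurable_cst.
  under eq_fun do rewrite big_cons; apply: measurable_funD.
    apply: measurable_funM; last exact: measurable_funP.
    apply: measurableT_comp; last exact: measurable_funP.
    by apply: measurable_indic; apply: Km; rewrite mem_head.
  by apply: IHK => Bx BK; apply: Km; rewrite in_cons BK orbT.
exists f; split=> // l.
pose g : {sfun borel X >-> R} := \sum_(Ax <- L) \1_(Ax.1) l *: Ax.2.
have gE x : g x = \sum_(Ax <- L) \1_(Ax.1) l * (Ax.2 : {sfun borel X >-> R}) x.
  by rewrite /g sfun_sum.
have gI : EFin \o g \in Lp_integrable l p.
  rewrite -(mem_Lp_integrable l p1); apply: sfun_Lfun => //.
  exact: probability_setT_lty.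
have fg : {ae l, forall x, (EFin \o f) x = (EFin \o g) x}.
  apply: filterS (decomposition_map_fiber beta_decomposition l) => x bx /=.
  by rewrite gE /f bx.
have fI : EFin \o f \in Lp_integrable l p.
  by apply: (Lp_integrable_ae_eq _ gI fg); exact/measurable_EFinP.
split=> //; rewrite tE; apply/esym/(Lp_class_eq p1 fI gI).
by apply: filterS fg => x + _.
Qed.

(** The function that represents an integrable simple section is in L^p(mu) by
    disintegration of its [p]-th power. *)
Lemma disintegration_map_surjective (y : Lp_direct_integral F nu p1) :
  exists x, disintegration_map x = y.
Proof.
apply: (isometric_dense_surjective disintegration_map_linear disintegration_map_norm).
  exact: Lp_banach.
move=> {}y e e_gt0; have [s sP ->] := section_class_surj y.
have [t [ts tP ste]] := simple_section_dense p1 sP e_gt0.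
have [f [mf ft]] := simple_section_fiber ts.
have tE : t = fiber_section (EFin \o f).
  apply: functional_extensionality_dep => l; have [fI ->] := ft l.
  by rewrite fiber_sectionE.
have fI : EFin \o f \in Lp_integrable mu p.
  apply/(Lp_integrableP mu p1); split; first exact/measurable_EFinP.
  have [_] := (Lp_sectionP _ _ _).1 tP; rewrite fiber_integral_normX; last first.
    exact/measurable_EFinP.
  congr (_ < _)%E; apply: eq_integral => l _; have [flI ->] := ft l.
  by rewrite (Lp_class_normX p1 flI).
exists (Lp_class mu p1 (EFin \o f)); rewrite (disintegration_mapE fI) -tE.
exact: ste.
Qed.

End disintegrated_sections.

(** * Canonical representations *)

Section canonical_representation_theory.
Context (R : realType) (G : topologicalGroupType) (X : ptopologicalType).
Variables (act : G -> X -> X) (act_continuous : continuous_action act).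

Lemma actK g : cancel (act g) (act g^-1%g).
Proof.
by have [a1 aM _] := act_continuous => x; rewrite -aM mulVg a1.
Qed.

Lemma actVK g : cancel (act g^-1%g) (act g).
Proof.
by have [a1 aM _] := act_continuous => x; rewrite -aM mulgV a1.
Qed.

Lemma continuous_act g : continuous (act g).
Proof.
have [_ _ ac] := act_continuous => x.
apply: (@continuous_comp _ _ _ (fun y => (g, y)) (fun gx : G * X => act gx.1 gx.2)).
  by apply: cvg_pair; [exact: cvg_cst|exact: cvg_id].
exact: ac.
Qed.

Lemma measurable_act g : measurable_fun (setT : set (borel X)) (act g : borel X -> borel X).
Proof. by apply: continuous_borel; exact: continuous_act. Qed.

Lemma act_image g (Y : set X) : act g @` Y = act g^-1%g @^-1` Y.
Proof.
apply/seteqP; split=> [_ [x Yx <-]|x Yx] /=; first by rewrite actK.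
by exists (act g^-1%g x); last exact: actVK.
Qed.

Variables (l : {measure set (borel X) -> \bar R}) (l_invariant : invariant_measure act l).

Lemma invariant_preimage g (Y : set (borel X)) : measurable Y ->
  l (act g @^-1` Y) = l Y.
Proof.
by move=> mY; rewrite -(l_invariant g^-1%g mY) act_image invgK.
Qed.

Lemma ae_act g (P : borel X -> Prop) :
  {ae l, forall x, P x} -> {ae l, forall x : borel X, P (act g x)}.
Proof.
move=> [N [mN N0 PN]]; exists (act g @^-1` N); split.
- by rewrite -[_ @^-1` _]setTI; exact: measurable_act.
- by rewrite invariant_preimage.
- by move=> x Px; exact: PN.
Qed.

Lemma integral_act g (h : borel X -> \bar R) : measurable_fun setT h ->
  (forall x, 0 <= h x)%E -> (\int[l]_x h (act g x) = \int[l]_x h x)%E.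
Proof.
move=> mh h0.
rewrite -(ge0_integral_pushforward (measurable_act g) l measurableT mh)//.
apply: eq_measure_integral; first exact: measurable_act.
by move=> mact A mA _; exact: invariant_preimage.
Qed.

Variables (p : R) (p1 : 1 <= p).

Let p0 : 0 < p. Proof. exact: lt_le_trans p1. Qed.

Local Notation rho := (canonical_representation act p1 l).

Lemma translate_measurable g (f : borel X -> \bar R) : measurable_fun setT f ->
  measurable_fun setT (translate act g f : borel X -> \bar R).
Proof. by move=> mf; exact: (measurableT_comp mf (measurable_act g^-1%g)). Qed.

Lemma translate_integral g (f : borel X -> \bar R) : measurable_fun setT f ->
  (\int[l]_x (`|translate act g f x| `^ p) = \int[l]_x (`|f x| `^ p))%E.
Proof.
move=> mf; apply: (@integral_act g^-1%g (fun x => `|f x| `^ p)%E).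
  exact/(measurableT_comp (measurable_poweR p))/measurableT_comp.
by move=> x; exact: poweR_ge0.
Qed.

Lemma translate_Lp g (f : borel X -> \bar R) : f \in Lp_integrable l p ->
  (translate act g f : borel X -> \bar R) \in Lp_integrable l p.
Proof.
move=> /(Lp_integrableP l p1)[mf fy]; apply/(Lp_integrableP l p1).
by split; [exact: translate_measurable|rewrite translate_integral].
Qed.

Lemma canonical_representationE g (f : borel X -> \bar R) :
  f \in Lp_integrable l p ->
  rho g (Lp_class l p1 f) = Lp_class l p1 (translate act g f).
Proof.
move=> fP.
have rP : (repr (Lp_class l p1 f) : borel X -> \bar R) \in Lp_integrable l p.
  exact: valP.
apply/(Lp_class_eq p1 (translate_Lp g rP) (translate_Lp g fP)).
have /(Lp_class_eq p1 rP fP) := Lp_class_repr (Lp_class l p1 f).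
by move=> /(ae_act g^-1%g).
Qed.

Lemma canonical_representation_well_defined : canonical_well_defined act p1 l.
Proof.
by move=> g f fP; split; [exact: translate_Lp|exact: canonical_representationE].
Qed.

Lemma canonical_representation_linear g : linear (rho g).
Proof.
move=> a x y; have [[f fP ->] [h hP ->]] := (Lp_class_real x, Lp_class_real y).
have I (k : borel X -> R) : k \in Lfun l p%:E -> EFin \o k \in Lp_integrable l p.
  by rewrite (mem_Lp_integrable l p1).
have afP := LfunZ p1 a fP; have afhP := LfunD p1 afP hP.
rewrite -(Lp_classZ p1 a fP) -(Lp_classD p1 afP hP) !canonical_representationE ?I//.
have tP (k : borel X -> R) : k \in Lfun l p%:E ->
    (fun x => k (act g^-1%g x)) \in Lfun l p%:E.
  by move=> /I kI; rewrite (mem_Lp_integrable l p1); exact: translate_Lp kI.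
rewrite -(Lp_classZ p1 a (tP _ fP)) -(Lp_classD p1 (LfunZ p1 a (tP _ fP)) (tP _ hP)).
by [].
Qed.

Lemma canonical_representation_norm g x : `|rho g x| = `|x|.
Proof.
have [f fP ->] := Lp_class_surj x; rewrite canonical_representationE//.
have [mf _] := (Lp_integrableP l p1 f).1 fP.
apply: (powR_injective p0); rewrite ?nnegrE//; apply: EFin_inj.
by rewrite -!Lp_class_normX ?translate_Lp// translate_integral.
Qed.

Lemma canonical_representation1 : rho 1%g = id.
Proof.
apply/funext => x; have [f fP ->] := Lp_class_surj x.
rewrite canonical_representationE// (_ : translate act 1%g f = f)//.
by apply/funext => y; have [a1 _ _] := act_continuous; rewrite /translate invg1 a1.
Qed.

Lemma canonical_representationM g h : rho (g * h)%g = rho g \o rho h.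
Proof.
apply/funext => x; have [f fP ->] := Lp_class_surj x.
rewrite /= (canonical_representationE _ fP) (canonical_representationE _ fP).
rewrite (canonical_representationE _ (translate_Lp _ fP)).
rewrite (_ : translate act (g * h)%g f = translate act g (translate act h f))//.
by apply/funext => y; have [_ aM _] := act_continuous; rewrite /translate invgM aM.
Qed.

Lemma canonical_representation_le g x y : x ≼ y -> rho g x ≼ rho g y.
Proof.
have [[f fP ->] [h hP ->]] := (Lp_class_surj x, Lp_class_surj y).
rewrite !canonical_representationE// => /(Lp_class_le p1 fP hP) fh.
apply/Lp_class_le; [exact: translate_Lp|exact: translate_Lp|].
exact: (ae_act g^-1%g fh).
Qed.

Lemma canonical_representationK g : cancel (rho g) (rho g^-1%g).
Proof.
move=> x; rewrite -[rho _ _]/((rho g^-1%g \o rho g) x) -canonical_representationM.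
by rewrite mulVg canonical_representation1.
Qed.

Lemma canonical_representation_isometric : isometric_lattice_representation rho.
Proof.
split=> [|g].
  split.
  - move=> g; split; first exact: canonical_representation_linear.
    by exists 1 => x; rewrite canonical_representation_norm mul1r.
  - exact: canonical_representation1.
  - exact: canonical_representationM.
have gK := canonical_representationK g.
have gVK : cancel (rho g^-1%g) (rho g).
  by have := canonical_representationK g^-1%g; rewrite invgK.
split.
- apply: order_iso_lattice_hom; first exact: canonical_representation_linear.
    by move=> y; exists (rho g^-1%g y); rewrite gVK.
  move=> x y; split; first exact: canonical_representation_le.
  by move=> /(canonical_representation_le g^-1%g); rewrite !gK.
- by exists (rho g^-1%g).
- exact: canonical_representation_norm.
Qed.

End canonical_representation_theory.

(** * Direct integrals of canonical representations *)

Lemma section_class_repr d (Omega : measurableType d) (R : realType)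
    (V : orderedVectorType R) (F : banach_lattice_family Omega V)
    (nu : {measure set Omega -> \bar R}) (p : R) (p1 : 1 <= p)
    (q : Lp_direct_integral F nu p1) : section_class F nu p1 (repr q) = q.
Proof.
rewrite -[RHS]reprK /section_class; congr \pi%qT; apply/val_inj.
by rewrite insubdK//; exact: valP.
Qed.

(** Fiberwise isometries do not change the norm of a section, so they preserve
    integrability as soon as they preserve measurability. *)
Lemma isometric_operator_well_defined d (Omega : measurableType d) (R : realType)
    (V : orderedVectorType R) (F : banach_lattice_family Omega V)
    (nu : {measure set Omega -> \bar R}) (p : R) (p1 : 1 <= p)
    (T : forall w, F w -> F w) :
  (forall s : section F, measurable_section s ->
    measurable_section ((fun w => T w (s w)) : section F)) ->
  (forall w x, `|T w x| = `|x|) -> integral_operator_well_defined F nu p1 T.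
Proof.
move=> mT nT s sP.
have TP (t : section F) : t \in Lp_section F nu p ->
    ((fun w => T w (t w)) : section F) \in Lp_section F nu p.
  move=> /Lp_sectionP[mt ty]; apply/Lp_sectionP; split; first exact: mT.
  by under eq_integral do rewrite nT.
split; first exact: TP.
pose r : section F := repr (section_class F nu p1 s).
have rP : r \in Lp_section F nu p by exact: valP.
apply/(section_class_eq p1 (TP _ rP) (TP _ sP)).
have /(section_class_eq p1 rP sP) := section_class_repr (section_class F nu p1 s).
by apply: filterS => w ->.
Qed.

Section fiber_representations.

Import HBSimple.

Context (R : realType) (G : topologicalGroupType) (X : ptopologicalType).
Variables (act : G -> X -> X) (act_continuous : continuous_action act).
Variables (e0 : ergodic_measure R act) (p : R) (p1 : 1 <= p).

Local Notation E := (borel (ergodic_space e0)).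

Variable H : measurable_banach_lattice_family (Omega := E)
  (V := {sfun borel X >-> R}) (B := fun l => Lp (ergodic_prob l) p1)
  (fun l => simple_seminorm p l) (fun l => simple_class p1 l).

Local Notation F := (BanachLatticeFamily H).
Local Notation rho l := (canonical_representation act p1 (ergodic_prob l)).

Lemma translate_sfun_subproof g (f : {sfun borel X >-> R}) :
  ((fun x => f (act g^-1%g x)) : borel X -> R) \in sfun.
Proof.
apply/andP; split; apply/mem_set => /=.
  apply: (@measurableT_comp _ _ _ _ _ _ f); first exact: measurable_funP.
  exact: measurable_act.
apply: (sub_finite_set _ (fimfunP f)) => _ [x _ <-].
by exists (act g^-1%g x).
Qed.

Definition translate_sfun g f : {sfun borel X >-> R} :=
  sfun_Sub (translate_sfun_subproof g f).

Lemma fiber_section_translate g (f : X -> \bar R) (l : E) :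
  disintegrated_section p1 (translate act g f) l =
  rho l g (disintegrated_section p1 f l).
Proof.
have il : invariant_measure act l by exact: ergodic_invariant.
have tE : (translate act g f \in Lp_integrable l p) = (f \in Lp_integrable l p).
  apply/idP/idP; last exact: translate_Lp.
  move=> /(translate_Lp act_continuous il p1 g^-1%g).
  rewrite (_ : translate act _ _ = f)//; apply/funext => x.
  by rewrite /translate invgK actK.
rewrite /disintegrated_section tE; case: ifPn => fP.
  by rewrite canonical_representationE.
have [_ _ _ -> _] := linear_additive
  (@canonical_representation_linear _ _ _ _ act_continuous _ il _ p1 g).
by [].
Qed.

Lemma simple_section_translate g (s : section F) : simple_section s ->
  simple_section ((fun l => rho l g (s l)) : section F).
Proof.
move=> [L Lm sE]; exists [seq (Ax.1, translate_sfun g Ax.2) | Ax <- L].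
  by move=> _ /mapP[Ax /Lm mA ->].
move=> l; rewrite sE big_map /=.
have il : invariant_measure act l by exact: ergodic_invariant.
pose f : {sfun borel X >-> R} := \sum_(Ax <- L) \1_(Ax.1) l *: Ax.2.
pose h : {sfun borel X >-> R} :=
  \sum_(Ax <- L) \1_(Ax.1) l *: translate_sfun g Ax.2.
suff : rho l g (simple_class p1 l f) = simple_class p1 l h by exact.
have fI : EFin \o f \in Lp_integrable l p.
  rewrite -(mem_Lp_integrable l p1); apply: sfun_Lfun => //.
  exact: probability_setT_lty.
rewrite /simple_class (canonical_representationE act_continuous il p1 g fI).
rewrite (_ : translate act g (EFin \o f) = EFin \o h)//.
by apply/funext => x; rewrite /translate /= /f /h !sfun_sum.
Qed.

(** Translation maps simple sections to simple sections, and fiberwise limits to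
    fiberwise limits since it is isometric in every fiber. *)
Lemma measurable_section_translate g (s : section F) : measurable_section s ->
  measurable_section ((fun l => rho l g (s l)) : section F).
Proof.
move=> [s_ ss sl].
exists (fun k => (fun l => rho l g (s_ k l)) : section F) => [k|l].
  exact: simple_section_translate.
have il : invariant_measure act l by exact: ergodic_invariant.
suff : rho l g (s_ k l) @[k --> \oo] --> rho l g (s l) by exact.
have sl' : s_ k l @[k --> \oo] --> (s l : Lp l p1) by exact: sl.
apply/cvgrPdist_lt => e e_gt0; move/cvgrPdist_lt : sl' => /(_ e e_gt0).
have [_ B _ _ _] := linear_additive
  (@canonical_representation_linear _ _ _ _ act_continuous _ il _ p1 g).
by apply: filterS => k; rewrite -B canonical_representation_norm.
Qed.

Lemma decomposable_canonical_representation (nu : {measure set E -> \bar R}) :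
  decomposable_representation F nu (fun l => rho l).
Proof.
have il (l : E) : invariant_measure act l by exact: ergodic_invariant.
split=> [l|g].
  by have [] := canonical_representation_isometric act_continuous (il l) p1.
split=> [l|s|].
- have [[+ _ _] _] := canonical_representation_isometric act_continuous (il l) p1.
  exact.
- exact: measurable_section_translate.
- exists 1; apply: aeW => l; apply: operator_norm_le1 => x.
  exact: (canonical_representation_norm act_continuous (il l)).
Qed.

Lemma canonical_integral_operator_well_defined (nu : {measure set E -> \bar R}) g :
  integral_operator_well_defined F nu p1 (fun l => rho l g).
Proof.
apply: isometric_operator_well_defined.
  exact: measurable_section_translate.
move=> l x; apply: canonical_representation_norm => //; exact: ergodic_invariant.
Qed.

End fiber_representations.

(** * Order indecomposability of the fibers *)

Section disjoint_classes.
Context d (T : measurableType d) (R : realType).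
Variables (mu : {measure set T -> \bar R}) (p : R) (p1 : 1 <= p).
Implicit Types f g : T -> R.

Local Notation cl f := (Lp_class mu p1 (EFin \o f)).

Lemma Lfun0 : cst 0 \in Lfun mu p%:E.
Proof. exact: (LfunP (0 : LfunType mu (p1 : (1 <= p%:E)%E))). Qed.

Lemma Lp_class0 : cl (cst 0) = 0.
Proof.
have := Lp_classB p1 Lfun0 Lfun0; rewrite subrr => <-; congr Lp_class.
by apply/funext => x /=; rewrite subrr.
Qed.

(** The class of [min (`|f|, `|g|)] is a lower bound of the two moduli. *)
Lemma disjoint_classes_ae f g : f \in Lfun mu p%:E -> g \in Lfun mu p%:E ->
  disjoint_elements (cl f) (cl g) -> {ae mu, forall x, f x = 0 \/ g x = 0}.
Proof.
move=> fP gP; pose h x := Num.min `|f x| `|g x|.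
have hP : h \in Lfun mu p%:E.
  apply: (Lfun_dominated p1 _ fP) => [|x].
    apply: measurable_minr.
      exact: measurableT_comp (Lfun_measurable fP).
    exact: measurableT_comp (Lfun_measurable gP).
  by rewrite /h ger0_norm ?ge_min ?lexx// le_min !normr_ge0.
move=> /(_ _ _ (Lp_class_modulus p1 fP) (Lp_class_modulus p1 gP)) /is_inf2P[_ _ inf].
have : cl h ≼ 0.
  apply: inf; apply/(Lp_real_class_le p1 hP); rewrite ?Lfun_normr//.
    by apply: aeW => x /=; rewrite ge_min lexx.
  by apply: aeW => x /=; rewrite ge_min lexx orbT.
rewrite -Lp_class0 => /(Lp_real_class_le p1 hP Lfun0); apply: filterS => x.
by rewrite /h /= ge_min !normr_le0 => /orP[] /eqP; [left|right].
Qed.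

End disjoint_classes.

Section ergodic_indecomposable.
Context (R : realType) (G : topologicalGroupType) (X : ptopologicalType).
Variables (act : G -> X -> X) (act_continuous : continuous_action act).
Variables (l : probability (borel X) R) (il : invariant_measure act l).
Hypothesis l_ergodic : forall Y : set (borel X), measurable Y ->
  (forall g, l ((act g @` Y) `+` Y) = 0) -> l Y = 0 \/ l Y = 1%E.
Variables (p : R) (p1 : 1 <= p).

Local Notation cl f := (Lp_class l p1 (EFin \o f)).
Local Notation rho := (canonical_representation act p1 l).

(** One inclusion between [Y] and its translates is enough: the inclusion for
    the inverse of [g], transported by [g], is the reverse inclusion for [g]. *)
Lemma ergodic_ae_invariant (Y : set (borel X)) : measurable Y ->
  (forall g, {ae l, forall x : borel X, Y (act g^-1%g x) -> Y x}) -> l Y = 0%E \/ l Y = 1%E.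
Proof.
move=> mY gY; apply: l_ergodic => // g.
have mgY : measurable (act g @` Y : set (borel X)).
  by rewrite act_image// -[_ @^-1` _]setTI; exact: measurable_act.
apply/negligibleP.
  by rewrite setY_def; apply: measurableU; exact: measurableD.
suff [N [mN N0 SN]] : {ae l, forall x : borel X, ~ ((act g @` Y) `+` Y) x}.
  by exists N; split=> // x Sx; apply: SN => /(_ Sx).
have /(ae_act act_continuous il g^-1%g) := gY g^-1%g.
apply: filterS2 (gY g) => x gx xg; rewrite setY_def act_image// => -[[/= h1 h2]|[/= h1 h2]].
  exact/h2/gx.
by apply: h2; apply: xg; rewrite invgK actVK.
Qed.

Lemma ergodic_order_indecomposable : order_indecomposable rho.
Proof.
move=> A [[[A0 _ _ _] _] dec] Ainv.
have one : cst 1 \in Lfun l p%:E.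
  exact: (sfun_Lfun p1 (probability_setT_lty l) (cst_sfun 1)).
(* The constant function 1 is a weak unit. *)
have disj1 x : disjoint_elements x (cl (cst 1)) -> x = 0.
  have [h hP ->] := Lp_class_real x => /(disjoint_classes_ae hP one) h0.
  rewrite -(Lp_class0 l p1); apply/(Lp_real_class_eq p1 hP (Lfun0 l p1)).
  by apply: filterS h0 => t [//|/eqP]; rewrite oner_eq0.
have [y [z [Ay Az yz]]] := dec (cl (cst 1)).
have [f fP yE] := Lp_class_real y; have [h hP zE] := Lp_class_real z.
have fh1 : {ae l, forall x, 1 = f x + h x}.
  apply/(Lp_real_class_eq p1 one (LfunD p1 fP hP)).
  by rewrite Lp_classD// -yE -zE.
pose Y : set (borel X) := [set x | f x != 0].
have mY : measurable Y.
  have mf := Lfun_measurable fP; rewrite (_ : Y = ~` (f @^-1` [set 0])).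
    by apply: measurableC; rewrite -[_ @^-1` _]setTI; exact: mf.
  by apply/seteqP; split=> x /eqP.
(* [f + h = 1] and one of [f], [h] vanishes, so [f] takes the values 0 and 1. *)
have fY : {ae l, forall x, f x = \1_Y x}.
  have := Az _ Ay; rewrite yE zE => /(disjoint_classes_ae hP fP).
  apply: filterS2 fh1 => x fhx hf; rewrite indicE.
  have [fx0|fx0] := eqVneq (f x) 0; first by rewrite memNset// /Y /= fx0 => /eqP.
  rewrite mem_set//; case: hf => [hx0|/eqP]; last by rewrite (negPf fx0).
  by rewrite fhx hx0 addr0.
(* The translate of [y] by [g] is in the band, hence disjoint from [z], the
   indicator of the complement of [Y]. *)
have gY g : {ae l, forall x : borel X, Y (act g^-1%g x) -> Y x}.
  have fI : EFin \o f \in Lp_integrable l p by rewrite -(mem_Lp_integrable l p1).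
  have tI := translate_Lp act_continuous il p1 g fI.
  have tP : (fun x => f (act g^-1%g x)) \in Lfun l p%:E.
    by rewrite (mem_Lp_integrable l p1).
  have Ag : A (cl (fun x => f (act g^-1%g x))).
    have : A (rho g y) by apply: (Ainv g); exists y.
    by rewrite yE (canonical_representationE act_continuous il p1 g fI).
  have := Az _ Ag; rewrite zE => /(disjoint_classes_ae hP tP).
  apply: filterS2 fh1 => x fhx [hx0 _|fx0]; last by rewrite /Y /= fx0 eqxx.
  by apply/eqP => fx0; move: fhx; rewrite fx0 hx0 addr0 => /eqP; rewrite oner_eq0.
have [Y0|Y1] := ergodic_ae_invariant mY gY.
  left; apply/seteqP; split=> [x Ax|_ ->//].
  have y0 : y = 0.
    rewrite yE -(Lp_class0 l p1); apply/(Lp_real_class_eq p1 fP (Lfun0 l p1)).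
    have NY : {ae l, forall x, ~ Y x}.
      by exists Y; split => // t /contrapT.
    by apply: filterS2 fY NY => t -> Yt; rewrite indicE memNset.
  suff : x = 0 by [].
  apply: disj1; have := Az _ Ax; rewrite -[z]add0r -y0 -yz.
  by rewrite /disjoint_elements => zx ax a1 mx m1; rewrite setUC; exact: zx.
right; apply/seteqP; split=> // x _.
have A1 : A (cl (cst 1)).
  suff <- : y = cl (cst 1) by [].
  rewrite yE; apply/(Lp_real_class_eq p1 fP one).
  have YT : {ae l, forall x, Y x}.
    exists (~` Y); split=> //; first exact: measurableC.
    by rewrite probability_setC// Y1 subee.
  by apply: filterS2 fY YT => t -> Yt; rewrite indicE mem_set.
have [x1 [x2 [Ax1 Ax2 ->]]] := dec x.
by rewrite (disj1 _ (Ax2 _ A1)) addr0.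
Qed.

End ergodic_indecomposable.

Theorem theorem4p9 (R : realType) (G : topologicalGroupType)
    (X : ptopologicalType) (act : G -> X -> X)
    (G_polish : polish R G) (X_polish : polish R X)
    (G_locally_compact : locally_compact [set: G])
    (act_continuous : continuous_action act)
    (mu : probability (borel X) R) (mu_invariant : invariant_measure act mu)
    (e0 : ergodic_measure R act)
    (beta : {mfun borel X >-> borel (ergodic_space e0)})
    (beta_decomposition : decomposition_map beta)
    (p : R) (p1 : 1 <= p) :
  let E := borel (ergodic_space e0) in
  let nu : probability E R := distribution mu beta in
  (forall beta' : {mfun borel X >-> E}, decomposition_map beta' ->
     forall A : set E, measurable A -> distribution mu beta' A = nu A) /\
  exists H : measurable_banach_lattice_family (Omega := E)
      (V := {sfun borel X >-> R}) (B := fun l => Lp (ergodic_prob l) p1)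
      (fun l => simple_seminorm p l) (fun l => simple_class p1 l),
  let F := BanachLatticeFamily H in
  let DI := Lp_direct_integral F nu p1 in
  let s (f : X -> \bar R) : section F := fun l => disintegrated_section p1 f l in
  let rho_mu := canonical_representation act p1 mu in
  let rho (l : E) := canonical_representation act p1 (ergodic_prob l) in
  let rho_DI (g : G) := integral_operator F nu p1 (fun l => rho l g) in
  banach_lattice DI /\
  (exists S : Lp mu p1 -> DI,
    [/\ forall f, f \in Lp_integrable mu p ->
          s f \in Lp_section F nu p /\
          S (Lp_class mu p1 f) = section_class F nu p1 (s f),
        isometric_lattice_iso S &
        forall g, S \o rho_mu g = rho_DI g \o S]) /\
  [/\ canonical_well_defined act p1 mu /\ isometric_lattice_representation rho_mu,
      forall l : E, canonical_well_defined act p1 (ergodic_prob l) /\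
        isometric_lattice_representation (rho l),
      decomposable_representation F nu rho &
      (forall g, integral_operator_well_defined F nu p1 (fun l => rho l g)) /\
        representation rho_DI] /\
  forall l : E, order_indecomposable (rho l).
Proof.
move=> E nu; have X_metrizable : completely_metrizable R X by case: X_polish.
split.
  by move=> beta' dec' A mA; exact: decomposition_map_distribution.
pose H := @ergodic_Lp_family R G X act e0 p p1 X_metrizable.
exists H; move=> F DI s rho_mu rho rho_DI.
pose S : Lp mu p1 -> DI := @disintegration_map R G X act e0 p p1 mu beta H.
have il (l : E) : invariant_measure act l by exact: ergodic_invariant.
have lS : linear S by exact: disintegration_map_linear.
have nS x : `|S x| = `|x| by exact: disintegration_map_norm.
have sS y : exists x, S x = y by exact: disintegration_map_surjective.
have leS x y : x ≼ y <-> S x ≼ S y by exact: disintegration_map_le.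
have wd g : integral_operator_well_defined F nu p1 (fun l => rho l g).
  exact: canonical_integral_operator_well_defined.
have ES g x : S (rho_mu g x) = rho_DI g (S x).
  have [f fP ->] := Lp_class_surj x.
  have tP := translate_Lp act_continuous mu_invariant p1 g fP.
  have sfP : s f \in Lp_section F nu p by exact: fiber_section_Lp.
  rewrite /rho_mu (canonical_representationE act_continuous mu_invariant p1 g fP).
  rewrite /S (disintegration_mapE X_metrizable mu_invariant beta_decomposition H fP).
  rewrite (disintegration_mapE X_metrizable mu_invariant beta_decomposition H tP).
  apply: (eq_trans _ (esym (wd g _ sfP).2)); congr section_class.
  apply: functional_extensionality_dep => l.
  exact: fiber_section_translate.
have rmu := canonical_representation_isometric act_continuous mu_invariant p1.
split.
  apply: (isometric_banach_lattice lS nS sS leS); exact: Lp_banach_lattice.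
split.
  exists S; split.
  - move=> f fP; split; first exact: fiber_section_Lp.
    exact: disintegration_mapE.
  - split; [exact: order_iso_lattice_hom lS sS leS| |exact: nS].
    (* Injectivity comes from antisymmetry, as S reflects the order. *)
    have /choice[T TS] := sS; exists T => // x; apply: vle_anti; apply/leS.
      by rewrite TS; exact: vle_refl.
    by rewrite TS; exact: vle_refl.
  - by move=> g; apply/funext => x; exact: ES.
split; last first.
  move=> l; apply: (ergodic_order_indecomposable act_continuous (il l)).
  exact: ergodic_trivial.
split.
- split; last exact: rmu.
  exact: (canonical_representation_well_defined act_continuous mu_invariant p1).
- move=> l; split.
    exact: (canonical_representation_well_defined act_continuous (il l) p1).
  exact: (canonical_representation_isometric act_continuous (il l) p1).
- exact: (decomposable_canonical_representation act_continuous H nu).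
- split; first exact: wd.
  exact: (representation_transport lS nS sS ES rmu.1).
Qed.
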